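(* Let $u_h\in V^h_{\mathrm{DG}}$ be the fine grid solution, i.e. $a_{\mathrm{DG}}(u_h,v)=(f,v)$ for all $v\in V^h_{\mathrm{DG}}$, and let $u_H\in V^{\mathrm{off}}$ be the GMsDGM solution, i.e. $a_{\mathrm{DG}}(u_H,v)=(f,v)$ for all $v\in V^{\mathrm{off}}$. Let $u_1$ be the function whose restriction to each coarse block $K_i$ is the harmonic extension of $u_h$: $u_1|_{K_i}\in V_h(K_i)$, $u_1=u_h|_{K_i}$ on $\partial K_i$, and $\int_{K_i}\kappa\nabla u_1\cdot\nabla v=0$ for all $v\in V_h^0(K_i)$. Then, with a constant $C>0$ depending only on $\gamma$ and $C_{\mathrm{inv}}$, $$\|u_h-u_H\|_{\mathrm{DG}}^2\le C\Big(\sum_{i=1}^N\frac{H}{\widetilde\kappa\,\lambda^{(i)}_{1,l_{1,i}+1}}\Big(1+\frac{\gamma H}{h\,\lambda^{(i)}_{1,l_{1,i}+1}}\Big)\int_{\partial K_i}(\kappa\nabla u_1\cdot n_{\partial K_i})^2+\sum_{i=1}^N\frac{H^2}{\lambda^{(i)}_{2,l_{2,i}+1}}\|f\|_{L^2(K_i)}^2+C_{\mathrm{inv}}^2\sum_{E\in\mathcal{E}^H}\frac1h\int_E\overline\kappa[u_h]^2\Big).$$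
   Context: **Meshes and coefficient.** $D$ is a (two-dimensional polygonal) domain, $f\in L^2(D)$, $(f,v)=\int_D fv$, and $\kappa:D\to\mathbb{R}$ is a bounded coefficient with $\kappa\ge 1$. $\mathcal{T}^H=\{K_1,\dots,K_N\}$ is a coarse mesh of $D$ of mesh size $H$ (its elements are called coarse blocks), $\mathcal{E}^H$ is the set of all coarse edges (interior and boundary), and $\mathcal{T}^h$ is a fine triangulation of mesh size $h$ that is a conforming refinement of $\mathcal{T}^H$. **Spaces.** For a coarse block $K$, $V_h(K)$ is the conforming piecewise linear finite element space on $K$ with respect to the fine grid, $V_h^0(K)$ its subspace of functions vanishing on $\partial K$, and $V_h(\partial K)$ the space of restrictions of $V_h(K)$ to $\partial K$. $V^h_{\mathrm{DG}}=\{v\in L^2(D): v|_K\in V_h(K)\ \forall K\in\mathcal{T}^H\}$. For $v\in V_h(\partial K)$, its harmonic extension $\widehat v\in V_h(K)$ is defined by $\widehat v=v$ on $\partial K$ and $\int_K\kappa\nabla\widehat v\cdot\nabla w=0$ for all $w\in V_h^0(K)$. **Coefficients on edges.** $\kappa_K$ is the maximum of $\kappa$ over $K$. For an interior coarse edge $E$ shared by $K^+,K^-$, $\overline\kappa=(\kappa_{K^+}+\kappa_{K^-})/2$ on $E$; for $E\subset\partial D$ an edge of $K$, $\overline\kappa=\kappa_K$. For a block $K_i$, $\widetilde\kappa$ (depending on $i$) is the maximum of $\overline\kappa$ over all coarse edges $E\subset\partial K_i$. **Averages and jumps.** On an interior edge $E$ shared by $K^+,K^-$, with fixed unit normal $n_E$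 pointing from $K^+$ to $K^-$, $\{G\}=\frac12(G^++G^-)$ and $[G]=G^+-G^-$, with $G^\pm=G|_{K^\pm}$. On a boundary edge, $\{G\}=[G]=G$ and $n_E$ points out of $D$. **Normal flux.** For $u\in V_h(K)$, with outward unit normal $n_{\partial K}$, the flux $\kappa\nabla u\cdot n_{\partial K}$ is understood as the element of $V_h(\partial K)$ defined by $\int_{\partial K}(\kappa\nabla u\cdot n_{\partial K})\,v=\int_K\kappa\nabla u\cdot\nabla\widehat v$ for all $v\in V_h(\partial K)$. On an edge $E\subset\partial K$, $\kappa\nabla u\cdot n_E$ (from the side of $K$) is the restriction to $E$ of $\pm\kappa\nabla u\cdot n_{\partial K}$, with sign $+$ if $n_E=n_{\partial K}$ and $-$ if $n_E=-n_{\partial K}$. **Forms and norm.** $a_H(u,v)=\sum_{K\in\mathcal{T}^H}a_H^K(u,v)$ with $a_H^K(u,v)=\int_K\kappa\nabla u\cdot\nabla v$, and for a penalty parameter $\gamma>0$ $$a_{\mathrm{DG}}(u,v)=a_H(u,v)-\sum_{E\in\mathcal{E}^H}\int_E\big(\{\kappa\nabla u\cdot n_E\}[v]+\{\kappa\nabla v\cdot n_E\}[u]\big)+\sum_{E\in\mathcal{E}^H}\frac{\gamma}{h}\int_E\overline\kappa[u][v],$$ $$\|u\|_{\mathrm{DG}}^2=a_H(u,u)+\sum_{E\in\mathcal{E}^H}\frac{\gamma}{h}\int_E\overline\kappa[u]^2.$$ $C_{\mathrm{inv}}>0$ is a constant such that for every coarse block $K$ and every $v\in V_h(\partial K)$,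 $a_H^K(\widehat v,\widehat v)\le\kappa_K C_{\mathrm{inv}}^2h^{-1}\int_{\partial K}|v|^2$. It is assumed that $\gamma>C_{\mathrm{inv}}^2$. **Snapshot and offline spaces.** For each $i$, $V_1^{i,\mathrm{snap}}\subset V_h(K_i)$ is the space of all harmonic extensions $\widehat v$, $v\in V_h(\partial K_i)$, with dimension $M^{i,\mathrm{snap}}$, and $V_2^{i,\mathrm{snap}}=V_h^0(K_i)$. Let $(\phi^{(i)}_k,\lambda^{(i)}_{1,k})$ be the eigenpairs, $\phi_k^{(i)}\in V_1^{i,\mathrm{snap}}$, of $$\int_{K_i}\kappa\nabla\phi^{(i)}_k\cdot\nabla v=\frac{\lambda^{(i)}_{1,k}}{H}\int_{\partial K_i}\widetilde\kappa\,\phi^{(i)}_kv\quad\forall v\in V_1^{i,\mathrm{snap}},\qquad \lambda^{(i)}_{1,1}<\lambda^{(i)}_{1,2}<\cdots,$$ and $(\xi^{(i)}_k,\lambda^{(i)}_{2,k})$ the eigenpairs, $\xi_k^{(i)}\in V_2^{i,\mathrm{snap}}$, of $$\int_{K_i}\kappa\nabla\xi^{(i)}_k\cdot\nabla v=\frac{\lambda^{(i)}_{2,k}}{H^2}\int_{K_i}\kappa\,\xi^{(i)}_kv\quad\forall v\in V_2^{i,\mathrm{snap}},\qquad \lambda^{(i)}_{2,1}<\lambda^{(i)}_{2,2}<\cdots.$$ (The strict ordering is an assumption.) Given numbers $l_{1,i},l_{2,i}$, set $V_1^{i,\mathrm{off}}=\mathrm{span}\{\phi^{(i)}_l:1\le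 l\le l_{1,i}\}$ and $V_2^{i,\mathrm{off}}=\mathrm{span}\{\xi^{(i)}_l:1\le l\le l_{2,i}\}$. $V^{\mathrm{off}}$ is the set of all $v$ with $v|_{K_i}\in V_1^{i,\mathrm{off}}+V_2^{i,\mathrm{off}}$ for every $i$. The numbers $l_{j,i}$ are such that $\lambda^{(i)}_{j,l_{j,i}+1}$ exists and is positive (in particular $l_{1,i}\ge1$). *)

(* Defs.v *)
From HB Require Import structures.
From mathcomp Require Import all_boot all_order all_algebra.
From mathcomp Require Import all_classical all_reals all_analysis.

Set Implicit Arguments.
Unset Strict Implicit.
Unset Printing Implicit Defensive.

Import Order.TTheory GRing.Theory Num.Theory.
Import numFieldNormedType.Exports.

Local Open Scope classical_set_scope.
Local Open Scope ring_scope.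

Notation plane R := (measurableTypeR R * measurableTypeR R)%type.

Section Plane.
Context {R : realType}.
Local Notation pt := (plane R).

Definition area : {measure set pt -> \bar R} :=
  ((@lebesgue_measure R) \x (@lebesgue_measure R))%E.

Definition edist (x y : pt) : R :=
  Num.sqrt ((x.1 - y.1) ^+ 2 + (x.2 - y.2) ^+ 2).

Definition diameter (A : set pt) : R :=
  sup [set edist p.1 p.2 | p in A `*` A].

Definition boundary (A : set pt) : set pt := closure A `\` interior A.

Definition along (e : pt * pt) (t : R) : pt :=
  (line_path e.1.1 e.2.1 t, line_path e.1.2 e.2.2 t).

Definition segment (e : pt * pt) : set pt := along e @` `[0, 1]%classic.

Definition line_integral (e : pt * pt) (g : pt -> R) : R :=
  edist e.1 e.2 * \int[@lebesgue_measure R]_(t in `[0, 1]) g (along e t).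

(* Convex hull of the vertices of a that are indexed by F. *)
Definition face (a : 'I_3 -> pt) (F : {set 'I_3}) : set pt :=
  [set x | exists c : 'I_3 -> R,
     [/\ forall j, 0 <= c j, forall j, j \notin F -> c j = 0, \sum_j c j = 1
       & x = (\sum_j c j * (a j).1, \sum_j c j * (a j).2)]].

Definition triangle (a : 'I_3 -> pt) : set pt := face a [set: 'I_3].

Definition nondegenerate (a : 'I_3 -> pt) : Prop :=
  let a0 := a ord0 in let a1 := a (inord 1) in let a2 := a (inord 2) in
  (a1.1 - a0.1) * (a2.2 - a0.2) - (a2.1 - a0.1) * (a1.2 - a0.2) != 0.

Definition affine_on (A : set pt) (v : pt -> R) : Prop :=
  exists g1 g2 c : R, forall x, A x -> v x = g1 * x.1 + g2 * x.2 + c.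

(* Real vector spaces of functions on a subset of the plane; the functions are
   extended by zero, so equality of functions is Leibniz equality. *)
Definition in_span (n : nat) (b : nat -> pt -> R) : set (pt -> R) :=
  [set v | exists c : nat -> R, v = fun x => \sum_(k < n) c k * b k x].

Definition has_dim (V : set (pt -> R)) (n : nat) : Prop :=
  exists b : nat -> pt -> R,
    [/\ forall k, (k < n)%N -> V (b k),
        forall c : nat -> R, (forall x, \sum_(k < n) c k * b k x = 0) ->
          forall k, (k < n)%N -> c k = 0
      & V `<=` in_span n b].

(* (phi_k, lam_k), k < n = dim V, are the eigenpairs in V of the problem
   a(phi, v) = (lam / s) b(phi, v) for all v in V, with lam_0 < lam_1 < ...;
   the numbering starts at 0, not at 1. *)
Definition eigenpairs (V : set (pt -> R)) (a b : (pt -> R) -> (pt -> R) -> R)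
    (s : R) (n : nat) (phi : nat -> pt -> R) (lam : nat -> R) : Prop :=
  [/\ has_dim V n,
      forall k, (k < n)%N -> V (phi k) /\ (exists x, phi k x != 0),
      forall k, (k < n)%N ->
        forall v, V v -> a (phi k) v = lam k / s * b (phi k) v
    & forall j k, (j < k)%N -> (k < n)%N -> lam j < lam k].

End Plane.

(* A polygonal domain with its coarse mesh and a fine triangulation.  The
   coarse blocks are open polygons; the fine triangles and the edges are
   closed.  Every coarse edge e is oriented by its normal n_e, which points out
   of the block eplus e, into the block K^- when eminus e = Some K^- (interior
   edge), out of the domain when eminus e = None (boundary edge). *)
Record mesh (R : realType) := Mesh {
  nfine : nat;
  tri : 'I_nfine -> 'I_3 -> plane R;
  dom : set (plane R);
  nblk : nat;
  blk : 'I_nblk -> set (plane R);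
  nedge : nat;
  edge : 'I_nedge -> plane R * plane R;
  eplus : 'I_nedge -> 'I_nblk;
  eminus : 'I_nedge -> option 'I_nblk;

  tri_nondegenerate : forall t, nondegenerate (tri t);
  tri_conforming : forall s t, s != t -> exists F G : {set 'I_3},
    [/\ F != [set: 'I_3]%SET,
        triangle (tri s) `&` triangle (tri t) = face (tri s) F
      & face (tri s) F = face (tri t) G];
  dom_tri : dom = interior (\bigcup_t triangle (tri t));
  dom_neq0 : dom !=set0;
  dom_connected : connected dom;

  blk_open : forall i, open (blk i);
  blk_neq0 : forall i, blk i !=set0;
  blk_connected : forall i, connected (blk i);
  (* no slits *)
  blk_regular : forall i, interior (closure (blk i)) = blk i;
  blk_disjoint : forall i j, i != j -> blk i `&` blk j = set0;
  blk_cover : closure dom = \bigcup_i closure (blk i);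

  edge_neq : forall e, (edge e).1 != (edge e).2;
  edge_inter : forall e e', e != e' ->
    segment (edge e) `&` segment (edge e') `<=`
      [set (edge e).1; (edge e).2] `&` [set (edge e').1; (edge e').2];
  edge_blk : forall e i, segment (edge e) `<=` boundary (blk i) <->
    (i == eplus e) || (Some i == eminus e);
  edge_two_sides : forall e, eminus e != Some (eplus e);
  edge_dom : forall e, eminus e = None -> segment (edge e) `<=` boundary dom;
  blk_boundary : forall i, boundary (blk i) =
    \bigcup_(e in [set e | segment (edge e) `<=` boundary (blk i)])
       segment (edge e);

  (* conforming refinement *)
  tri_blk : forall t, exists i, triangle (tri t) `<=` closure (blk i);
  edge_vertices : forall e x, [set (edge e).1; (edge e).2] x ->
    exists t j, x = tri t j
}.

Section Spaces.
Context {R : realType} (m : mesh R).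
Local Notation pt := (plane R).

Definition fine_size : R :=
  \big[Num.max/0]_(t < nfine m) diameter (triangle (tri t)).

Definition coarse_size : R :=
  \big[Num.max/0]_(i < nblk m) diameter (blk i).

Definition in_blk (i : 'I_(nblk m)) (t : 'I_(nfine m)) : bool :=
  `[< triangle (tri t) `<=` closure (blk i) >].

(* The edge e is contained in the boundary of the block i, see edge_blk. *)
Definition adj (i : 'I_(nblk m)) (e : 'I_(nedge m)) : bool :=
  (i == eplus e) || (Some i == eminus e).

Definition bd_integral (i : 'I_(nblk m)) (g : pt -> R) : R :=
  \sum_(e < nedge m | adj i e) line_integral (edge e) g.

Definition Vh (i : 'I_(nblk m)) : set (pt -> R) :=
  [set v | [/\ forall x, ~ closure (blk i) x -> v x = 0,
               {within closure (blk i), continuous v}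
             & forall t, in_blk i t -> affine_on (triangle (tri t)) v]].

Definition Vh0 (i : 'I_(nblk m)) : set (pt -> R) :=
  [set v | Vh i v /\ forall x, boundary (blk i) x -> v x = 0].

Definition trace (i : 'I_(nblk m)) (v : pt -> R) : pt -> R :=
  v \_ (boundary (blk i)).

Definition Vh_bd (i : 'I_(nblk m)) : set (pt -> R) := trace i @` Vh i.

(* A broken function is given by the family of its restrictions to the
   (closures of the) coarse blocks; it is two-valued on the coarse edges. *)
Definition broken := 'I_(nblk m) -> pt -> R.

Definition VDG : set broken := [set v | forall i, Vh i (v i)].

Definition avg (e : 'I_(nedge m)) (G : broken) (x : pt) : R :=
  if eminus e is Some j then (G (eplus e) x + G j x) / 2 else G (eplus e) x.

Definition jump (e : 'I_(nedge m)) (G : broken) (x : pt) : R :=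
  if eminus e is Some j then G (eplus e) x - G j x else G (eplus e) x.

(* The union of the coarse blocks is the domain up to a null set. *)
Definition load (f : pt -> R) (v : broken) : R :=
  \sum_(i < nblk m) \int[area]_(x in blk i) (f x * v i x).

Section Coefficient.
Variable kappa : pt -> R.

Definition kappa_blk (i : 'I_(nblk m)) : R := sup (kappa @` blk i).

Definition kappa_bar (e : 'I_(nedge m)) : R :=
  if eminus e is Some j then (kappa_blk (eplus e) + kappa_blk j) / 2
  else kappa_blk (eplus e).

Definition kappa_tilde (i : 'I_(nblk m)) : R :=
  \big[Num.max/0]_(e < nedge m | adj i e) kappa_bar e.

(* u and v are affine on each fine triangle; the fine edges are a null set. *)
Definition aK (i : 'I_(nblk m)) (u v : pt -> R) : R :=
  \sum_(t < nfine m | in_blk i t)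
    \int[area]_(x in interior (triangle (tri t)))
      (kappa x * ('D_((1, 0) : pt) u x * 'D_((1, 0) : pt) v x +
                  'D_((0, 1) : pt) u x * 'D_((0, 1) : pt) v x)).

Definition aH (u v : broken) : R := \sum_(i < nblk m) aK i (u i) (v i).

Definition harmonic_ext (i : 'I_(nblk m)) (v w : pt -> R) : Prop :=
  [/\ Vh i w, forall x, boundary (blk i) x -> w x = v x
    & forall z, Vh0 i z -> aK i w z = 0].

Definition is_flux (i : 'I_(nblk m)) (u q : pt -> R) : Prop :=
  Vh_bd i q /\
  forall v w, Vh_bd i v -> harmonic_ext i v w ->
    bd_integral i (fun x => q x * v x) = aK i u w.

Definition flux (i : 'I_(nblk m)) (u : pt -> R) : pt -> R :=
  xget (fun=> 0) [set q | is_flux i u q].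

(* The fluxes through e in the direction n_e, from the sides of e; n_e is the
   outward normal of eplus e and the inward normal of the other block. *)
Definition edge_flux (e : 'I_(nedge m)) (u : broken) : broken :=
  fun i x => if i == eplus e then flux i (u i) x else - flux i (u i) x.

Definition aDG (gamma : R) (u v : broken) : R :=
  aH u v
  - \sum_(e < nedge m) line_integral (edge e)
      (fun x => avg e (edge_flux e u) x * jump e v x
                + avg e (edge_flux e v) x * jump e u x)
  + \sum_(e < nedge m) gamma / fine_size *
      line_integral (edge e) (fun x => kappa_bar e * jump e u x * jump e v x).

Definition normDG_sq (gamma : R) (u : broken) : R :=
  aH u u
  + \sum_(e < nedge m) gamma / fine_size *
      line_integral (edge e) (fun x => kappa_bar e * jump e u x ^+ 2).

Definition inverse_inequality (Cinv : R) : Prop :=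
  forall i v w, Vh_bd i v -> harmonic_ext i v w ->
    aK i w w <= kappa_blk i * Cinv ^+ 2 / fine_size *
                bd_integral i (fun x => v x ^+ 2).

Definition V1snap (i : 'I_(nblk m)) : set (pt -> R) :=
  [set w | exists2 v, Vh_bd i v & harmonic_ext i v w].

Definition V2snap (i : 'I_(nblk m)) : set (pt -> R) := Vh0 i.

Definition eigenpairs1 (i : 'I_(nblk m)) :=
  eigenpairs (V1snap i) (aK i)
    (fun p v => bd_integral i (fun x => kappa_tilde i * p x * v x))
    coarse_size.

Definition eigenpairs2 (i : 'I_(nblk m)) :=
  eigenpairs (V2snap i) (aK i)
    (fun p v => \int[area]_(x in blk i) (kappa x * p x * v x))
    (coarse_size ^+ 2).

Definition Voff (phi xi : 'I_(nblk m) -> nat -> pt -> R)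
    (l1 l2 : 'I_(nblk m) -> nat) : set broken :=
  [set v | forall i, exists v1 v2,
     [/\ in_span (l1 i) (phi i) v1, in_span (l2 i) (xi i) v2
       & v i = v1 \+ v2]].

End Coefficient.
End Spaces.

(* Main.v *)
Require Import Defs.
From mathcomp Require Import all_boot all_order all_algebra.
From mathcomp Require Import all_classical all_reals all_analysis.
From mathcomp Require Import measurable_realfun ring lra.
Import Order.TTheory GRing.Theory Num.Theory.
Import numFieldNormedType.Exports.
Local Open Scope classical_set_scope.
Local Open Scope ring_scope.

Set Implicit Arguments.
Unset Strict Implicit.
Unset Printing Implicit Defensive.

(** The bilinear form a_DG is symmetric, and gamma > Cinv^2 makes it coercive
    and bounded for the DG norm, with constants that depend only on gamma and
    Cinv (penalty_absorbs, aDG_equiv). Indeed the flux q of u on a block K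
    satisfies |q|^2 <= kappa_K Cinv^2 / h a^K(u, u) on the boundary of K: test
    the definition of the flux with the harmonic extension of q itself and
    apply the inverse inequality (flux_bound). Summed over the edges, with
    kappa_bar the mean of the adjacent kappa_K, this bounds the consistency
    terms of a_DG by the energy and the jumps (consistency_young). By Galerkin
    orthogonality, the error uh - uH is then at most a constant times uh - v,
    for every v in the offline space (galerkin_quasi_optimal).

    On each block, uh = u1 + u2 with u1 harmonic and u2 vanishing on the
    boundary. The eigenfunctions of the two local problems are orthogonal bases
    of the two snapshot spaces (eigen_basis), so one may take for v the
    truncated expansions of u1 and u2, with tails e1 and e2. A tail e satisfies
    a(u, e) = a(e, e) and b(e, e) <= (s / lambda) a(e, e), where lambda is the
    first discarded eigenvalue (eigen_tail).

    For e1, a(e1, e1) = a(u1, e1) is the boundary pairing of e1 with the flux of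
    u1; Young's inequality and the spectral bound give
    a(e1, e1) <= H / (kappa_tilde lambda) |flux|^2, and once more the spectral
    bound for the trace of e1, which controls its jumps (V1_tail,
    jump_form_boundary). For e2, which has no trace, the fine grid equation
    tested with e2 expresses a(e2, e2) by the load and by the flux of e2 against
    the jump of uh; these produce the second and the third term of the estimate
    (interior_energy).

    Existence of harmonic extensions and of fluxes also comes from the two
    eigenbases (harmonic_ext_exists, flux_exists). That these are bases rests on
    one geometric fact: a finite element function that vanishes on the boundary
    of a block and has zero energy is zero, because it is continuous and takes
    finitely many values (piecewise_constant_eq0). *)

(** * Forms on subspaces and orthogonal eigenvectors *)

Section Forms.
Context {R : realType} {V : lmodType R}.
Implicit Types (S : set V) (a b : V -> V -> R) (u v w : V) (c : R).

(** Subspaces and forms are relative to a set S because the forms of the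
    discretization are given by integrals and derivatives of arbitrary
    functions, and are bilinear only on finite element functions. *)
Definition is_subspace S := S 0 /\ forall c u v, S u -> S v -> S (c *: u + v).

Definition semi_inner S a :=
  [/\ forall u v, S u -> S v -> a u v = a v u,
      forall c u v w, S u -> S v -> S w -> a (c *: u + v) w = c * a u w + a v w
    & forall u, S u -> 0 <= a u u].

Lemma subspaceD S u v : is_subspace S -> S u -> S v -> S (u + v).
Proof. by move=> [_ h] Su Sv; rewrite -[u]scale1r; exact: h. Qed.

Lemma subspaceZ S c u : is_subspace S -> S u -> S (c *: u).
Proof. by move=> [S0 h] Su; rewrite -[_ *: _]addr0; exact: h. Qed.

Lemma subspaceB S u v : is_subspace S -> S u -> S v -> S (u - v).
Proof.
move=> hS Su Sv; apply: subspaceD => //.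
by rewrite -scaleN1r; exact: subspaceZ.
Qed.

Lemma subspace_sum S n (F : 'I_n -> V) :
  is_subspace S -> (forall i, S (F i)) -> S (\sum_i F i).
Proof.
move=> hS hF; elim/big_ind : _ => //; first by case: hS.
by move=> u v; exact: subspaceD.
Qed.

Lemma semi_innerS S S' a : S `<=` S' -> semi_inner S' a -> semi_inner S a.
Proof.
move=> sub [h1 h2 h3]; split => [u v Su Sv|c u v w Su Sv Sw|u Su].
- by apply: h1; exact: sub.
- by apply: h2; exact: sub.
- by apply: h3; exact: sub.
Qed.

Section Rules.
Variables (S : set V) (a : V -> V -> R).
Hypotheses (hS : is_subspace S) (ha : semi_inner S a).

Let S0 : S 0. Proof. by case: hS. Qed.

Lemma formC u v : S u -> S v -> a u v = a v u.
Proof. by case: ha => h _ _; exact: h. Qed.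

Lemma form_ge0 u : S u -> 0 <= a u u.
Proof. by case: ha => _ _; exact. Qed.

Lemma form0l w : S w -> a 0 w = 0.
Proof.
move=> Sw; case: ha => _ h _; have := h 1 0 0 w S0 S0 Sw.
by rewrite scaler0 addr0 mul1r => /eqP; rewrite -subr_eq subrr eq_sym => /eqP.
Qed.

Lemma formDl u v w : S u -> S v -> S w -> a (u + v) w = a u w + a v w.
Proof.
by move=> Su Sv Sw; case: ha => _ h _; rewrite -{1}[u]scale1r h// mul1r.
Qed.

Lemma formZl c u w : S u -> S w -> a (c *: u) w = c * a u w.
Proof.
move=> Su Sw; case: ha => _ h _.
by rewrite -[_ *: _]addr0 h// form0l// addr0.
Qed.

Lemma formBl u v w : S u -> S v -> S w -> a (u - v) w = a u w - a v w.
Proof.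
move=> Su Sv Sw; rewrite -scaleN1r formDl ?formZl ?mulN1r//.
exact: subspaceZ.
Qed.

Lemma formDr u v w : S u -> S v -> S w -> a w (u + v) = a w u + a w v.
Proof.
move=> Su Sv Sw; rewrite formC// ?formDl//; last exact: subspaceD.
by rewrite [a u w]formC// [a v w]formC.
Qed.

Lemma formZr c u w : S u -> S w -> a w (c *: u) = c * a w u.
Proof.
move=> Su Sw; rewrite formC// ?formZl//; last exact: subspaceZ.
by rewrite [a u w]formC.
Qed.

Lemma formBr u v w : S u -> S v -> S w -> a w (u - v) = a w u - a w v.
Proof.
move=> Su Sv Sw; rewrite formC// ?formBl//; last exact: subspaceB.
by rewrite [a u w]formC// [a v w]formC.
Qed.

Lemma form_suml n (F : 'I_n -> V) w : (forall i, S (F i)) -> S w ->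
  a (\sum_i F i) w = \sum_i a (F i) w.
Proof.
move=> hF Sw.
suff [_ ->] : S (\sum_i F i) /\ a (\sum_i F i) w = \sum_i a (F i) w by [].
elim/big_ind2 : _ => //; first by rewrite form0l.
by move=> x1 x2 y1 y2 [? <-] [? <-]; rewrite formDl//; split => //; exact: subspaceD.
Qed.

Lemma form_sumr n (F : 'I_n -> V) w : (forall i, S (F i)) -> S w ->
  a w (\sum_i F i) = \sum_i a w (F i).
Proof.
move=> hF Sw; rewrite formC//; last exact: subspace_sum.
by rewrite form_suml//; apply: eq_bigr => i _; rewrite formC.
Qed.

Lemma form_sqD u v : S u -> S v ->
  a (u + v) (u + v) = a u u + 2 * a u v + a v v.
Proof.
move=> Su Sv; have Suv := subspaceD hS Su Sv.
by rewrite formDl// !formDr// [a v u]formC//; ring.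
Qed.

Lemma form_sqB u v : S u -> S v ->
  a (u - v) (u - v) = a u u - 2 * a u v + a v v.
Proof.
move=> Su Sv; have Suv := subspaceB hS Su Sv.
by rewrite formBl// !formBr// [a v u]formC//; ring.
Qed.

(** The weight t replaces the square roots of the Cauchy-Schwarz inequality. *)
Lemma form_young t u v : 0 < t -> S u -> S v ->
  2 * a u v <= t * a u u + t^-1 * a v v.
Proof.
move=> t0 Su Sv; have Stu := subspaceZ t hS Su.
have := form_ge0 (subspaceB hS Stu Sv).
rewrite form_sqB// !formZl// formZr// => h.
have ti0 : 0 < t^-1 by rewrite invr_gt0.
rewrite -subr_ge0; apply: le_trans (mulr_ge0 (ltW ti0) h) _; rewrite le_eqVlt; apply/orP; left.
by apply/eqP; field; rewrite gt_eqF.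
Qed.

End Rules.

Section Spectral.
Variables (S : set V) (a b : V -> V -> R).
Hypotheses (hS : is_subspace S) (ha : semi_inner S a) (hb : semi_inner S b).
(* A common isotropic vector of a and b would be an eigenvector for every
   eigenvalue, and the eigenvectors would no longer span S. *)
Hypothesis ab_definite : forall v, S v -> a v v = 0 -> b v v = 0 -> v = 0.
Variables (s : R) (n : nat) (phi : nat -> V) (lam : nat -> R).
Hypothesis s_gt0 : 0 < s.
Hypothesis phiS : forall k, (k < n)%N -> S (phi k).
Hypothesis phi_neq0 : forall k, (k < n)%N -> phi k != 0.
Hypothesis phi_eigen : forall k, (k < n)%N ->
  forall v, S v -> a (phi k) v = lam k / s * b (phi k) v.
Hypothesis lam_lt : forall j k, (j < k)%N -> (k < n)%N -> lam j < lam k.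
Hypothesis dimS : exists e : nat -> V,
  forall v, S v -> exists c : nat -> R, v = \sum_(k < n) c k *: e k.

Let phiSo (k : 'I_n) : S (phi k). Proof. exact: phiS. Qed.

Lemma eigen_orthb j k : (j < n)%N -> (k < n)%N -> j != k -> b (phi j) (phi k) = 0.
Proof.
wlog jk : j k / (j < k)%N.
  move=> h jn kn; rewrite neq_ltn => /orP[jk|kj].
    by apply: h => //; rewrite ltn_eqF.
  by rewrite (formC hb) ?h ?ltn_eqF//; exact: phiS.
move=> jn kn _; have Sj := phiS jn; have Sk := phiS kn.
have : (lam k - lam j) / s * b (phi j) (phi k) = 0.
  rewrite !mulrBl {1}(formC hb)// -phi_eigen// -phi_eigen//.
  by rewrite (formC ha)// subrr.
move/eqP; rewrite !mulf_eq0 invr_eq0 (gt_eqF s_gt0) orbF subr_eq0.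
by rewrite (gt_eqF (lam_lt jk kn)) => /eqP.
Qed.

Lemma eigen_ortha j k : (j < n)%N -> (k < n)%N -> j != k -> a (phi j) (phi k) = 0.
Proof.
by move=> jn kn jk; rewrite phi_eigen ?eigen_orthb ?mulr0//; exact: phiS.
Qed.

Lemma eigen_gt0 k : (k < n)%N -> 0 < b (phi k) (phi k).
Proof.
move=> kn; have Sk := phiS kn.
rewrite lt_def (form_ge0 hb)// andbT; apply: contra (phi_neq0 kn) => /eqP b0.
by apply/eqP/ab_definite => //; rewrite phi_eigen// b0 mulr0.
Qed.

Let pairing_sum (c : nat -> R) j : (j < n)%N ->
  b (\sum_(k < n) c k *: phi k) (phi j) = c j * b (phi j) (phi j).
Proof.
move=> jn; have Sj := phiS jn; rewrite (form_suml hS hb); [|by move=> i; exact: subspaceZ|exact: phiS].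
rewrite (bigD1 (Ordinal jn))//= (formZl hS hb)// big1 ?addr0// => i ij.
by rewrite (formZl hS hb)// eigen_orthb ?mulr0.
Qed.

(** The eigenvectors are independent by orthogonality, and there are as many of
    them as spanning vectors e: their matrix A of coefficients in terms of e is
    square with trivial kernel, so the e_j are combinations of eigenvectors. *)
Lemma eigen_basis v : S v -> exists c : nat -> R, v = \sum_(k < n) c k *: phi k.
Proof.
move=> Sv; have [e he] := dimS.
have [C hC] : exists C : nat -> nat -> R,
    forall k, (k < n)%N -> phi k = \sum_(j < n) C k j *: e j.
  have /choice[C hC] : forall k, exists c : nat -> R, (k < n)%N ->
      phi k = \sum_(j < n) c j *: e j.
    move=> k; case: (ltnP k n) => kn; last by exists (fun=> 0).
    by have [c hc] := he _ (phiS kn); exists c.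
  by exists C.
pose A : 'M[R]_n := \matrix_(k, j) C k j.
have phiA (k : 'I_n) : phi k = \sum_(j < n) A k j *: e j.
  by rewrite hC//; apply: eq_bigr => j _; rewrite mxE.
have Aunit : A \in unitmx.
  rewrite -row_free_unit; apply/row_freeP.
  suff /eqP k0 : kermx A == 0.
    exists (pinvmx A); apply: (@row_free_inj _ _ _ _ A).
      by rewrite -kermx_eq0 k0.
    by rewrite mul1mx mulmxKpV.
  rewrite -submx0; apply/rV_subP => x /sub_kermxP xA.
  suff -> : x = 0 by rewrite sub0mx.
  pose c k := if insub k is Some i then x 0 i else 0 : R.
  have cE (i : 'I_n) : c i = x 0 i by rewrite /c valK.
  apply/rowP => i; rewrite mxE -cE.
  have : \sum_(k < n) c k *: phi k = 0.
    under eq_bigr do rewrite phiA scaler_sumr.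
    rewrite exchange_big/= big1// => j _.
    under eq_bigr do rewrite cE scalerA.
    rewrite -scaler_suml.
    have := congr1 (fun M : 'rV[R]_n => M 0 j) xA; rewrite /= !mxE => ->.
    by rewrite scale0r.
  move=> /(congr1 (fun u => b u (phi i))); rewrite pairing_sum// (form0l hS hb)//.
  by move=> /eqP; rewrite mulf_eq0 (gt_eqF (eigen_gt0 _))// orbF => /eqP.
have [d vd] := he _ Sv.
pose D : 'rV[R]_n := (\row_j d j) *m invmx A.
exists (fun k => if insub k is Some i then D 0 i else 0).
transitivity (\sum_(k < n) D 0 k *: phi k); last first.
  by apply: eq_bigr => i _; rewrite valK.
under eq_bigr do rewrite phiA scaler_sumr.
rewrite exchange_big/= vd; apply: eq_bigr => j _.
under eq_bigr do rewrite scalerA.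
rewrite -scaler_suml; congr (_ *: _).
have : D *m A = \row_j d j by rewrite /D mulmxKV.
by move=> /(congr1 (fun M : 'rV[R]_n => M 0 j)); rewrite !mxE => ->.
Qed.

(** Orthogonality of the eigenvectors makes both forms diagonal, and the
    eigenvalues of the discarded terms are at least lam l. *)
Lemma eigen_tail l v : (l < n)%N -> 0 < lam l -> S v ->
  exists c : nat -> R, let e := v - \sum_(k < l) c k *: phi k in
  [/\ S e, a v e = a e e & b e e <= s / lam l * a e e].
Proof.
move=> ln l0 Sv; have [c vE] := eigen_basis Sv.
exists c => e.
pose d k := if (k < l)%N then 0 else c k.
have eE : e = \sum_(k < n) d k *: phi k.
  rewrite /e vE (big_ord_widen n (fun k => c k *: phi k) (ltnW ln)).
  rewrite [X in _ - X]big_mkcond -sumrB; apply: eq_bigr => i _ /=.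
  by rewrite /d; case: ifP => _; rewrite ?subrr ?scale0r// subr0.
have dS (x : nat -> R) (k : 'I_n) : S (x k *: phi k) by exact: subspaceZ.
have Se : S e by rewrite eE; exact: subspace_sum.
have diag (f : V -> V -> R) (x y : nat -> R) : semi_inner S f ->
    (forall j k, (j < n)%N -> (k < n)%N -> j != k -> f (phi j) (phi k) = 0) ->
    f (\sum_(k < n) x k *: phi k) (\sum_(k < n) y k *: phi k) =
    \sum_(k < n) x k * y k * f (phi k) (phi k).
  move=> hf forth; rewrite (form_suml hS hf)//; last exact: subspace_sum.
  apply: eq_bigr => i _; rewrite (form_sumr hS hf)// (bigD1 i)//= big1 => [|j ji].
    by rewrite addr0 (formZl hS hf)// (formZr hS hf)//; ring.
  rewrite (formZl hS hf)// (formZr hS hf)// forth ?mulr0// eq_sym//.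
have bS := eigen_orthb; have aS := eigen_ortha.
split => //.
  rewrite eE {1}vE !diag//; apply: eq_bigr => i _.
  by rewrite /d; case: ifP => _; rewrite ?mulr0 ?mul0r.
rewrite eE !diag// mulr_sumr; apply: ler_sum => i _.
rewrite /d; case: ifPn => [_|]; first by rewrite !mul0r mulr0.
rewrite -leqNgt => li; have b0 := eigen_gt0 (ltn_ord i).
rewrite phi_eigen// [leRHS](_ : _ = (lam i / lam l) *
    (c i * c i * b (phi i) (phi i))); last by field; rewrite !gt_eqF.
rewrite ler_peMl//; first by rewrite mulr_ge0 ?(ltW b0)// -expr2 sqr_ge0.
rewrite ler_pdivlMr// mul1r; move: li; rewrite leq_eqVlt => /orP[/eqP->//|il].
by apply/ltW/lam_lt.
Qed.

End Spectral.
End Forms.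

(** * Topology and area of the plane, triangles *)

Section PlaneFacts.
Context {R : realType}.
Local Notation pt := (plane R).
Implicit Types (A : set pt) (a : 'I_3 -> pt) (x y : pt).

Lemma open_square A x : open A -> A x ->
  exists2 e : R, 0 < e &
    forall y, `|y.1 - x.1| < e -> `|y.2 - x.2| < e -> A y.
Proof.
move=> oA Ax; have : nbhs x A by exact: open_nbhs_nbhs.
move=> /nbhs_ballP[e /= e0 he]; exists e => // y h1 h2.
by apply: he; split; rewrite /= -ball_normE /= distrC.
Qed.

(** An open set is the union of the rational boxes it contains. *)
Lemma open_measurable_plane A : open A -> measurable A.
Proof.
move=> oA.
pose box (q : (rat * rat) * (rat * rat)) : set pt :=
  `]ratr q.1.1, ratr q.1.2[ `*` `]ratr q.2.1, ratr q.2.2[.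
have mbox q : measurable (box q) by apply: measurableX.
pose F q := if `[< box q `<=` A >] then box q else set0.
have -> : A = \bigcup_q F q.
  apply/seteqP; split => [x Ax|x [q _]]; last first.
    by rewrite /F; case: asboolP => // qA; exact: qA.
  have [e e0 he] := open_square oA Ax.
  have side (t : R) : exists p : rat * rat,
      [/\ ratr p.1 < t, t < ratr p.2, t - e < ratr p.1 & ratr p.2 < t + e].
    have /rat_in_itvoo[p] : t - e < t by lra.
    rewrite in_itv/= => /andP[p1 p2].
    have /rat_in_itvoo[q] : t < t + e by lra.
    by rewrite in_itv/= => /andP[q1 q2]; exists (p, q).
  have [p1 [a1 a2 a3 a4]] := side x.1; have [p2 [b1 b2 b3 b4]] := side x.2.
  exists (p1, p2) => //; rewrite /F; case: asboolP => [_|].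
    by split; rewrite /= in_itv/= ?a1 ?a2 ?b1 ?b2.
  case=> y [] /=; rewrite !in_itv/= => /andP[y1 y2] /andP[y3 y4].
  by apply: he; rewrite ltr_norml; apply/andP; split; lra.
apply: countable_bigcupT_measurable; first exact: countableP.
by move=> q; rewrite /F; case: ifP.
Qed.

Lemma area_box (p q r s : R) : p <= q -> r <= s ->
  area ([set` `[p, q]] `*` [set` `[r, s]]) = ((q - p) * (s - r))%:E.
Proof.
move=> pq rs; rewrite [LHS]product_measure1E//.
move: (lebesgue_measure_itv `[p, q]) (lebesgue_measure_itv `[r, s]) => /= -> ->.
rewrite !lte_fin.
have -> : (if p < q then (q%:E - p%:E)%E else 0%E) = (q - p)%:E.
  by case: ltP => // qp; have -> : q = p; [lra|rewrite subrr].
have -> : (if r < s then (s%:E - r%:E)%E else 0%E) = (s - r)%:E.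
  by case: ltP => // sr; have -> : s = r; [lra|rewrite subrr].
by rewrite EFinM.
Qed.

Lemma area_open_gt0 A : open A -> A !=set0 -> (0 < area A)%E.
Proof.
move=> oA [x Ax]; have [e e0 he] := open_square oA Ax.
pose d := e / 2; have d0 : 0 < d by rewrite /d; lra.
have de : d < e by rewrite /d; lra.
pose B : set pt := [set` `[x.1 - d, x.1 + d]] `*` [set` `[x.2 - d, x.2 + d]].
have mB : measurable B by exact: measurableX.
apply: (@lt_le_trans _ _ (area B)).
  rewrite area_box; [|lra|lra].
  by rewrite lte_fin mulr_gt0//; lra.
apply: le_measure; rewrite ?inE//; first exact: open_measurable_plane.
move=> y [] /=; rewrite !in_itv/= => /andP[y1 y2] /andP[y3 y4].
by apply: he; rewrite ltr_norml; apply/andP; split; lra.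
Qed.

Definition in_square (B : R) : set pt := [set x | `|x.1| <= B /\ `|x.2| <= B].

Lemma area_bounded A (B : R) : measurable A -> A `<=` in_square B ->
  (area A < +oo)%E.
Proof.
move=> mA AB; pose B' := Num.max B 0.
have B0 : 0 <= B' by rewrite le_max lexx orbT.
pose D : set pt := [set` `[- B', B']] `*` [set` `[- B', B']].
have mD : measurable D by exact: measurableX.
apply: (@le_lt_trans _ _ (area D)); last by rewrite area_box ?ltry//; lra.
apply: le_measure; rewrite ?inE// => x /AB[x1 x2].
by split; rewrite /= in_itv/= -ler_norml le_max ?x1 ?x2.
Qed.

Lemma edist_ge x y : 0 <= Defs.edist x y.
Proof. exact: sqrtr_ge0. Qed.

Lemma edist_gt0 x y : x != y -> 0 < Defs.edist x y.
Proof.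
move=> xy; rewrite sqrtr_gt0 lt_def addr_ge0 ?sqr_ge0// andbT.
apply: contra xy; rewrite paddr_eq0 ?sqr_ge0// !sqrf_eq0 !subr_eq0.
by move=> /andP[/eqP h1 /eqP h2]; apply/eqP/injective_projections.
Qed.

Lemma diameter_gt0 A (B : R) x y : A `<=` in_square B -> A x -> A y -> x != y ->
  0 < diameter A.
Proof.
move=> AB Ax Ay xy; apply: (lt_le_trans (edist_gt0 xy)).
apply: ub_le_sup; last by exists (x, y).
exists (Num.sqrt ((B + B) ^+ 2 + (B + B) ^+ 2)) => _ [[p q] [/= Ap Aq] <-].
have [p1 p2] := AB _ Ap; have [q1 q2] := AB _ Aq.
have bnd (s t : R) : `|s| <= B -> `|t| <= B -> (s - t) ^+ 2 <= (B + B) ^+ 2.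
  move=> hs ht; rewrite -[leLHS]real_normK ?num_real//.
  have B0 : 0 <= B + B by have := normr_ge0 s; lra.
  rewrite ler_pXn2r ?nnegrE//.
  by apply: le_trans (ler_normB _ _) _; lra.
by apply: ler_wsqrtr; rewrite lerD// bnd.
Qed.

(** Barycentric coordinates, by Cramer's rule; they describe a triangle by
    three affine inequalities, which makes it closed and exhibits its
    interior. *)
Definition bary1 a x : R :=
  let a0 := a ord0 in let a1 := a (inord 1) in let a2 := a (inord 2) in
  ((x.1 - a0.1) * (a2.2 - a0.2) - (a2.1 - a0.1) * (x.2 - a0.2)) /
  ((a1.1 - a0.1) * (a2.2 - a0.2) - (a2.1 - a0.1) * (a1.2 - a0.2)).

Definition bary2 a x : R :=
  let a0 := a ord0 in let a1 := a (inord 1) in let a2 := a (inord 2) in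
  ((a1.1 - a0.1) * (x.2 - a0.2) - (x.1 - a0.1) * (a1.2 - a0.2)) /
  ((a1.1 - a0.1) * (a2.2 - a0.2) - (a2.1 - a0.1) * (a1.2 - a0.2)).

Definition bary0 a x : R := 1 - bary1 a x - bary2 a x.

Lemma sum_ord3 (F : 'I_3 -> R) :
  \sum_j F j = F ord0 + F (inord 1) + F (inord 2).
Proof.
rewrite !big_ord_recl big_ord0 addr0 addrA; congr (_ + F _ + F _);
  by apply: val_inj; rewrite /= inordK.
Qed.

Lemma ord3_cases (j : 'I_3) : [\/ j = ord0, j = inord 1 | j = inord 2].
Proof.
case: j => -[|[|[|//]]] h; [constructor 1|constructor 2|constructor 3];
  by apply: val_inj; rewrite /= ?inordK.
Qed.

Lemma triangleE a : Defs.nondegenerate a ->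
  triangle a = [set x | [/\ 0 <= bary0 a x, 0 <= bary1 a x & 0 <= bary2 a x]].
Proof.
move=> nda; have := nda; rewrite /Defs.nondegenerate => D0.
apply/seteqP; split => [x [c [c0 _ c1 xE]]|x [h0 h1 h2]].
  move: c1; rewrite sum_ord3 => c1.
  have e1 : bary1 a x = c (inord 1).
    rewrite /bary1 xE/= !sum_ord3.
    have -> : c ord0 = 1 - c (inord 1) - c (inord 2) by lra.
    by field.
  have e2 : bary2 a x = c (inord 2).
    rewrite /bary2 xE/= !sum_ord3.
    have -> : c ord0 = 1 - c (inord 1) - c (inord 2) by lra.
    by field.
  split; rewrite ?e1 ?e2//= /bary0 e1 e2.
  by have := c0 ord0; lra.
pose c (j : 'I_3) := if j == ord0 then bary0 a x else
  if j == inord 1 then bary1 a x else bary2 a x.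
have c_0 : c ord0 = bary0 a x by rewrite /c eqxx.
have n10 : (inord 1 == ord0 :> 'I_3) = false by apply/eqP => /(congr1 val); rewrite /= inordK.
have n20 : (inord 2 == ord0 :> 'I_3) = false by apply/eqP => /(congr1 val); rewrite /= inordK.
have n21 : (inord 2 == inord 1 :> 'I_3) = false by apply/eqP => /(congr1 val); rewrite /= !inordK.
have c_1 : c (inord 1) = bary1 a x by rewrite /c n10 eqxx.
have c_2 : c (inord 2) = bary2 a x by rewrite /c n20 n21.
exists c; split.
- by move=> j; case: (ord3_cases j) => ->; rewrite ?c_0 ?c_1 ?c_2.
- by move=> j; rewrite inE.
- by rewrite sum_ord3 c_0 c_1 c_2 /bary0; ring.
rewrite !sum_ord3 c_0 c_1 c_2 /bary0 /bary1 /bary2.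
by apply: injective_projections => /=; field.
Qed.

Lemma plane_affine_continuous (g1 g2 c : R) :
  continuous (fun x : pt => g1 * x.1 + g2 * x.2 + c).
Proof.
move=> x; apply: cvgD; last exact: cvg_cst.
by apply: cvgD; apply: cvgMr; [exact: cvg_fst|exact: cvg_snd].
Qed.

Lemma bary1_affine a : exists g1 g2 c, forall x, bary1 a x = g1 * x.1 + g2 * x.2 + c.
Proof.
set D := (((a (inord 1)).1 - (a ord0).1) * ((a (inord 2)).2 - (a ord0).2) -
          ((a (inord 2)).1 - (a ord0).1) * ((a (inord 1)).2 - (a ord0).2))^-1.
exists (((a (inord 2)).2 - (a ord0).2) * D), (- ((a (inord 2)).1 - (a ord0).1) * D),
  ((- (a ord0).1 * ((a (inord 2)).2 - (a ord0).2) +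
    ((a (inord 2)).1 - (a ord0).1) * (a ord0).2) * D) => x.
by rewrite /bary1 -/D; ring.
Qed.

Lemma bary2_affine a : exists g1 g2 c, forall x, bary2 a x = g1 * x.1 + g2 * x.2 + c.
Proof.
set D := (((a (inord 1)).1 - (a ord0).1) * ((a (inord 2)).2 - (a ord0).2) -
          ((a (inord 2)).1 - (a ord0).1) * ((a (inord 1)).2 - (a ord0).2))^-1.
exists (- ((a (inord 1)).2 - (a ord0).2) * D), (((a (inord 1)).1 - (a ord0).1) * D),
  ((- (a ord0).2 * ((a (inord 1)).1 - (a ord0).1) +
    ((a (inord 1)).2 - (a ord0).2) * (a ord0).1) * D) => x.
by rewrite /bary2 -/D; ring.
Qed.

Lemma bary_continuous a :
  [/\ continuous (bary0 a), continuous (bary1 a) & continuous (bary2 a)].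
Proof.
have [p1 [p2 [p3 h1]]] := bary1_affine a.
have [q1 [q2 [q3 h2]]] := bary2_affine a.
have c1 : continuous (bary1 a).
  by rewrite (funext h1 : bary1 a = _); exact: plane_affine_continuous.
have c2 : continuous (bary2 a).
  by rewrite (funext h2 : bary2 a = _); exact: plane_affine_continuous.
split => // x; apply: cvgB; last exact: c2.
by apply: cvgB; [exact: cvg_cst|exact: c1].
Qed.

Lemma triangle_closed a : Defs.nondegenerate a -> closed (triangle a).
Proof.
move=> nda; have [c0 c1 c2] := bary_continuous a.
have cl (f : pt -> R) : continuous f -> closed [set x | 0 <= f x].
  move=> cf; rewrite (_ : mkset _ = f @^-1` [set t | 0 <= t])//.
  by apply: (@closed_comp _ _ f) => //.
rewrite triangleE// (_ : mkset _ = [set x | 0 <= bary0 a x] `&`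
  ([set x | 0 <= bary1 a x] `&` [set x | 0 <= bary2 a x])).
  by apply: closedI; [|apply: closedI]; exact: cl.
by apply/seteqP; split => x /= [] => [? ? ?|? [? ?]].
Qed.

Lemma triangle_interior_neq0 a : Defs.nondegenerate a -> interior (triangle a) !=set0.
Proof.
move=> nda; have [c0 c1 c2] := bary_continuous a.
have op (f : pt -> R) : continuous f -> open [set x | 0 < f x].
  move=> cf; rewrite (_ : mkset _ = f @^-1` [set t | 0 < t])//.
  by apply: (@open_comp _ _ f) => //.
pose U := [set x | 0 < bary0 a x] `&` ([set x | 0 < bary1 a x] `&` [set x | 0 < bary2 a x]).
have oU : open U by apply: openI; [|apply: openI]; exact: op.
have UT : U `<=` triangle a by rewrite triangleE// => x [/ltW ? [/ltW ? /ltW ?]].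
pose x : pt := (3^-1 * ((a ord0).1 + (a (inord 1)).1 + (a (inord 2)).1),
          3^-1 * ((a ord0).2 + (a (inord 1)).2 + (a (inord 2)).2)).
have := nda; rewrite /Defs.nondegenerate => D0.
have e1 : bary1 a x = 3^-1 by rewrite /bary1 /x/=; field.
have e2 : bary2 a x = 3^-1 by rewrite /bary2 /x/=; field.
exists x; rewrite open_subsetE// in UT; apply: UT.
by rewrite /U /bary0/= e1 e2; split; [lra|split; lra].
Qed.

Lemma triangle_bounded a : exists B, triangle a `<=` in_square B.
Proof.
exists (\sum_j (`|(a j).1| + `|(a j).2|)) => x [c [c0 _ c1 ->]].
have cle j : c j <= 1.
  by rewrite -c1 (bigD1 j)//= lerDl; apply: sumr_ge0.
split => /=; apply: (le_trans (ler_norm_sum _ _ _)); apply: ler_sum => j _;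
  rewrite normrM (ger0_norm (c0 j)).
  by apply: le_trans (ler_piMl _ (cle j)) _ => //; rewrite lerDl.
by apply: le_trans (ler_piMl _ (cle j)) _ => //; rewrite lerDr.
Qed.

(** Near an interior point the difference quotients of v are constant. *)
Lemma derive_affine_on A (v : pt -> R) (g1 g2 c : R) x :
  (forall y, A y -> v y = g1 * y.1 + g2 * y.2 + c) -> interior A x ->
  'D_((1, 0) : pt) v x = g1 /\ 'D_((0, 1) : pt) v x = g2.
Proof.
move=> vE Ax.
have near_v : \near x, v x = g1 * x.1 + g2 * x.2 + c.
  by move: Ax; apply: filterS => y /vE.
have D (d : pt) : 'D_d (fun y : pt => g1 * y.1 + g2 * y.2 + c) x = g1 * d.1 + g2 * d.2.
  apply: cvg_lim => //.
  have h : (fun=> g1 * d.1 + g2 * d.2) t @[t --> (0 : R)^'] --> g1 * d.1 + g2 * d.2.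
    exact: cvg_cst.
  apply: cvg_trans h; apply: near_eq_cvg; near=> t; rewrite /= /GRing.scale/=.
  by field; near: t; exact: nbhs_dnbhs_neq.
by rewrite !(near_eq_derive _ near_v) !D/=; split; ring.
Unshelve. all: by end_near.
Qed.

End PlaneFacts.

(** * Geometry of the meshes *)

Section MeshFacts.
Context {R : realType} (m : mesh R).
Local Notation pt := (plane R).

Lemma tris_closed (P : set 'I_(nfine m)) :
  closed (\bigcup_(t in P) triangle (@tri _ m t)).
Proof.
apply: closed_bigcup => [|t _]; [exact: finite_finset|exact/triangle_closed/tri_nondegenerate].
Qed.

Lemma tris_bounded :
  exists B : R, \bigcup_t triangle (@tri _ m t) `<=` in_square B.
Proof.
have /choice[B hB] : forall t, exists B : R, triangle (@tri _ m t) `<=` in_square B.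
  by move=> t; exact: triangle_bounded.
exists (\sum_t `|B t|) => x [t _ /hB[x1 x2]].
have Bt : B t <= \sum_t `|B t|.
  rewrite (bigD1 t)//=; apply: le_trans (ler_norm _) _; rewrite lerDl.
  exact: sumr_ge0.
by split; exact: le_trans Bt.
Qed.

Lemma tri_interior_dom t : interior (triangle (@tri _ m t)) `<=` dom m.
Proof. by rewrite dom_tri; apply: interiorS => x xt; exists t. Qed.

Lemma closure_dom_tris : closure (dom m) `<=` \bigcup_t triangle (@tri _ m t).
Proof.
rewrite (closure_id (\bigcup_t _)).1; last exact: tris_closed.
by apply: closure_subset; rewrite dom_tri; exact: interior_subset.
Qed.

Lemma closure_blk_tris i : closure (@blk _ m i) `<=` \bigcup_t triangle (@tri _ m t).
Proof.
by move=> x xi; apply: closure_dom_tris; rewrite (@blk_cover _ m); exists i.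
Qed.

(** The union of the triangles is closed, so it contains the block together
    with the closure of the domain; an open set inside this union is inside its
    interior, the domain. *)
Lemma blk_dom i : @blk _ m i `<=` dom m.
Proof.
rewrite dom_tri -open_subsetE; last exact: blk_open.
by move=> x xi; apply: (@closure_blk_tris i); exact: subset_closure.
Qed.

Lemma closure_blk_bounded : exists B : R,
  forall i, closure (@blk _ m i) `<=` in_square B.
Proof.
have [B hB] := tris_bounded; exists B => i x /closure_blk_tris; exact: hB.
Qed.

(** A triangle that meets the open block i lies in the closure of some block
    j, and this j can only be i because the blocks are disjoint. *)
Lemma closure_blkE i :
  closure (@blk _ m i) = \bigcup_(t in [set t | in_blk i t]) triangle (@tri _ m t).
Proof.
apply/seteqP; split; last by move=> x [t /asboolP ti]; exact: ti.
rewrite (closure_id (\bigcup_(t in _) _)).1; last exact: tris_closed.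
apply: closure_subset => x xi.
have [t _ xt] := closure_blk_tris (subset_closure xi).
exists t => //; rewrite /= /in_blk; apply/asboolP.
have [j tj] := tri_blk t; suff -> : i = j by [].
apply/eqP/negPn/negP => ij.
have : nbhs x (@blk _ m i) by apply: open_nbhs_nbhs; split=> //; exact: blk_open.
move=> /(tj _ xt) [y [yj yi]].
by have := blk_disjoint ij; rewrite -subset0 => /(_ y); apply.
Qed.

Lemma fine_size_gt0 : 0 < fine_size m.
Proof.
have [x xd] := dom_neq0 m.
have [t _ _] := closure_dom_tris (subset_closure xd).
apply: (@lt_le_trans _ _ (diameter (triangle (@tri _ m t)))); last first.
  exact: le_bigmax.
have [p pt0] := triangle_interior_neq0 (@tri_nondegenerate _ m t).
have [e e0 he] := open_square (open_interior _) pt0.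
have [B hB] := triangle_bounded (@tri _ m t).
apply: (@diameter_gt0 _ _ B p (p.1 + e / 2, p.2)) => //.
- exact: interior_subset.
- apply: interior_subset; apply: he => /=; last by rewrite subrr normr0.
  by rewrite addrAC subrr add0r gtr0_norm; lra.
- by apply/eqP => /(congr1 fst)/=; lra.
Qed.

Lemma coarse_size_gt0 (i : 'I_(nblk m)) : 0 < coarse_size m.
Proof.
have [p pi] := blk_neq0 i.
apply: (@lt_le_trans _ _ (diameter (@blk _ m i))); last exact: le_bigmax.
have [e e0 he] := open_square (@blk_open _ m i) pi.
have [B hB] := closure_blk_bounded.
apply: (@diameter_gt0 _ _ B p (p.1 + e / 2, p.2)) => //.
- by move=> x xi; apply: (hB i); exact: subset_closure.
- apply: he => /=; last by rewrite subrr normr0.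
  by rewrite addrAC subrr add0r gtr0_norm; lra.
- by apply/eqP => /(congr1 fst)/=; lra.
Qed.

Lemma blk_measurable (i : 'I_(nblk m)) : measurable (@blk _ m i).
Proof. by apply: open_measurable_plane; exact: blk_open. Qed.

Lemma blk_finite (i : 'I_(nblk m)) : (area (@blk _ m i) < +oo)%E.
Proof.
have [B hB] := closure_blk_bounded.
apply: (@area_bounded _ _ B); first exact: blk_measurable.
by move=> x xi; apply: (hB i); exact: subset_closure.
Qed.

Lemma boundary_closure (A : set pt) : boundary A `<=` closure A.
Proof. by move=> x []. Qed.

Lemma adjP (i : 'I_(nblk m)) e :
  reflect (segment (edge e) `<=` boundary (@blk _ m i)) (adj i e).
Proof. by apply: (iffP idP) => /edge_blk. Qed.

Lemma boundaryE (i : 'I_(nblk m)) :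
  boundary (@blk _ m i) = \bigcup_(e in [set e | adj i e]) segment (edge e).
Proof.
rewrite blk_boundary; congr (\bigcup_(e in _) _); apply/seteqP.
by split=> e /=; [move/adjP|move/(adjP i e)].
Qed.

Lemma adj_eplus (e : 'I_(nedge m)) : adj (eplus e) e.
Proof. by rewrite /adj eqxx. Qed.

Lemma adj_eminus (e : 'I_(nedge m)) j : eminus e = Some j -> adj j e.
Proof. by rewrite /adj => ->; rewrite eqxx orbT. Qed.

Lemma eminus_neq (e : 'I_(nedge m)) j : eminus e = Some j -> (j == eplus e) = false.
Proof.
by move=> ej; apply/negbTE; have := edge_two_sides e; rewrite ej; apply: contra => /eqP ->.
Qed.

(** Traces and fluxes are controlled block by block, jumps edge by edge; this
    exchange of sums passes from one to the other. *)
Lemma sum_adj (F : 'I_(nblk m) -> 'I_(nedge m) -> R) :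
  \sum_(i < nblk m) \sum_(e < nedge m | adj i e) F i e =
  \sum_(e < nedge m) (F (eplus e) e + if eminus e is Some j then F j e else 0).
Proof.
under eq_bigr do rewrite big_mkcond.
rewrite exchange_big/=; apply: eq_bigr => e _.
rewrite -big_mkcond/= (bigD1 (eplus e))/= ?adj_eplus//; congr (_ + _).
case ej : (eminus e) => [j|].
  have jp := eminus_neq ej.
  rewrite (big_pred1 j)// => i; rewrite /adj ej.
  by case: (eqVneq i (eplus e)) => [->|_]/=; rewrite ?andbT// eq_sym jp.
rewrite big_pred0// => i; rewrite /adj ej orbF; exact: andbN.
Qed.

Section Kappa.
Variables (kappa : pt -> R) (B : R).
Hypotheses (kappa_le : forall x, dom m x -> kappa x <= B)
  (kappa_ge1 : forall x, dom m x -> 1 <= kappa x).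

Lemma kappa_blk_ge1 i : 1 <= kappa_blk (m := m) kappa i.
Proof.
have [x xi] := @blk_neq0 _ m i.
apply: (@le_trans _ _ (kappa x)); first exact/kappa_ge1/(@blk_dom i).
apply: ub_le_sup; last by exists x.
by exists B => _ [y yi <-]; exact/kappa_le/(@blk_dom i).
Qed.

Lemma kappa_bar_ge1 e : 1 <= kappa_bar (m := m) kappa e.
Proof.
rewrite /kappa_bar; case: (eminus e) => [j|]; last exact: kappa_blk_ge1.
by have := kappa_blk_ge1 (eplus e); have := kappa_blk_ge1 j; lra.
Qed.

Lemma kappa_bar_le i e : adj i e ->
  kappa_bar (m := m) kappa e <= kappa_tilde kappa i.
Proof. by move=> ie; rewrite /kappa_tilde (le_bigmax_cond _ _ ie). Qed.

Lemma kappa_tilde_ge0 i : 0 <= kappa_tilde (m := m) kappa i.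
Proof. by rewrite /kappa_tilde bigmax_ge_id. Qed.

End Kappa.
End MeshFacts.

(** * Integrals over edges and traces *)

Section EdgeIntegrals.
Context {R : realType}.
Local Notation pt := (plane R).
Local Notation mu := (@lebesgue_measure R).
Implicit Types (e : pt * pt) (f g : pt -> R).

Definition edge_cont e g := {within `[0, 1], continuous (g \o along e)}.

Lemma edge_cont_eq e f g : (forall x, segment e x -> f x = g x) ->
  edge_cont e f -> edge_cont e g.
Proof.
move=> fg; apply: subspace_eq_continuous => t /set_mem t01 /=.
by apply: fg; exists t.
Qed.

Lemma edge_cont_cst e c : edge_cont e (fun=> c).
Proof. by move=> x; exact: cvg_cst. Qed.

Lemma edge_contD e f g : edge_cont e f -> edge_cont e g ->
  edge_cont e (fun x => f x + g x).
Proof. by move=> cf cg x; apply: cvgD; [exact: cf|exact: cg]. Qed.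

Lemma edge_contN e f : edge_cont e f -> edge_cont e (fun x => - f x).
Proof. by move=> cf x; apply: cvgN; exact: cf. Qed.

Lemma edge_contM e f g : edge_cont e f -> edge_cont e g ->
  edge_cont e (fun x => f x * g x).
Proof. by move=> cf cg x; apply: cvgM; [exact: cf|exact: cg]. Qed.

Lemma edge_contZ e c f : edge_cont e f -> edge_cont e (fun x => c * f x).
Proof. by move=> cf; apply: edge_contM => //; exact: edge_cont_cst. Qed.

Lemma edge_contX e f : edge_cont e f -> edge_cont e (fun x => f x ^+ 2).
Proof. by move=> cf; exact: (edge_contM cf cf). Qed.

Lemma edge_integrable e g : edge_cont e g ->
  mu.-integrable `[0, 1] (EFin \o (g \o along e)).
Proof. by move=> cg; apply: continuous_compact_integrable => //; exact: segment_compact. Qed.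

Lemma line_integralD e f g : edge_cont e f -> edge_cont e g ->
  line_integral e (fun x => f x + g x) = line_integral e f + line_integral e g.
Proof.
move=> cf cg; rewrite /line_integral -mulrDr; congr (_ * _).
by apply: RintegralD => //; exact: edge_integrable.
Qed.

Lemma line_integralZ e c f : edge_cont e f ->
  line_integral e (fun x => c * f x) = c * line_integral e f.
Proof.
move=> cf; rewrite /line_integral mulrCA; congr (_ * _).
by apply: RintegralZl => //; exact: edge_integrable.
Qed.

Lemma eq_line_integral e f g : (forall x, segment e x -> f x = g x) ->
  line_integral e f = line_integral e g.
Proof.
move=> fg; rewrite /line_integral; congr (_ * _).
by apply: eq_Rintegral => t /set_mem t01; apply: fg; exists t.
Qed.

Lemma line_integral0 e : line_integral e (fun=> 0) = 0.
Proof.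
have := @line_integralZ e 0 (fun=> 0) (@edge_cont_cst e 0).
by rewrite !mul0r.
Qed.

Lemma le_line_integral e f g : edge_cont e f -> edge_cont e g ->
  (forall x, segment e x -> f x <= g x) -> line_integral e f <= line_integral e g.
Proof.
move=> cf cg fg; rewrite /line_integral ler_wpM2l ?edist_ge//.
by apply: le_Rintegral => //; [exact: edge_integrable..|move=> t t01; apply: fg; exists t].
Qed.

Lemma line_integral_ge0 e f : (forall x, segment e x -> 0 <= f x) ->
  0 <= line_integral e f.
Proof.
move=> f0; rewrite mulr_ge0 ?edist_ge//; apply: Rintegral_ge0 => t t01.
by apply: f0; exists t.
Qed.

(** A continuous function that is positive at one point of [0, 1] is bounded
    below by a positive constant on a subinterval. *)
Lemma Rintegral01_eq0 (g : R -> R) : {within `[0, 1], continuous g} ->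
  (forall t : R, 0 <= t <= 1 -> 0 <= g t) -> \int[mu]_(t in `[0, 1]) g t = 0 ->
  forall t : R, 0 <= t <= 1 -> g t = 0.
Proof.
move=> cg g0 ig t t01; apply/eqP/negPn/negP => gt_neq0.
have gt0 : 0 < g t by rewrite lt_def gt_neq0 g0.
have [d d0 hd] : exists2 d : R, 0 < d &
    forall s : R, 0 <= s <= 1 -> `|s - t| < d -> g t / 2 <= g s.
  have /subspace_continuousP := cg => /(_ t).
  rewrite /= in_itv/= t01 => /(_ isT)/cvgrPdist_lt/(_ (g t / 2)).
  have -> : 0 < g t / 2 by lra.
  move=> /(_ isT); rewrite near_withinE => /nbhs_ballP[d /= d0 hd].
  exists d => // s s01 st; have := hd s; rewrite /ball/= in_itv/= s01 distrC st.
  move=> /(_ isT isT) h; have {}h : `|g t - g s| < g t / 2 := h.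
  by move: h; rewrite ltr_norml => /andP[_ h]; lra.
pose p : R := Num.max 0 (t - d / 2); pose q := Num.min 1 (t + d / 2).
have [t0 t1] := andP t01.
have p0 : 0 <= p by rewrite le_max lexx.
have q1 : q <= 1 by rewrite ge_min lexx.
have pl : t - d / 2 <= p by rewrite le_max lexx orbT.
have ql : q <= t + d / 2 by rewrite ge_min lexx orbT.
have pq : p < q.
  by rewrite lt_min !gt_max; apply/andP; split; apply/andP; split; lra.
have ig' := @continuous_compact_integrable R g _ (@segment_compact R 0 1) cg.
have /integrableP[mg _] := ig'.
have pq01 : `[p, q] `<=` `[0, 1].
  by move=> s /=; rewrite !in_itv/= => /andP[? ?]; apply/andP; split; lra.
have I0 : (\int[mu]_(t in `[0%R, 1%R]) (g t)%:E = 0)%E.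
  have fin : (\int[mu]_(t in `[0%R, 1%R]) (g t)%:E)%E \is a fin_num.
    exact: integrable_fin_num.
  by have := fineK fin; rewrite -[fine _]/(\int[mu]_(t in `[0, 1]) g t) ig => <-.
have : ((g t / 2)%:E * mu `[p, q] <= 0)%E.
  rewrite -[X in (_ <= X)%E]I0 -integral_cst//.
  apply: (@le_trans _ _ (\int[mu]_(t in `[p, q]) (g t)%:E)%E).
    apply: ge0_le_integral => //.
    - by move=> s _; rewrite lee_fin; lra.
    - by apply: measurable_funS mg.
    - move=> s /=; rewrite in_itv/= => /andP[s1 s2]; rewrite lee_fin; apply: hd.
        by apply/andP; split; lra.
      by rewrite ltr_norml; apply/andP; split; lra.
  apply: (ge0_subset_integral mu _ _ mg) => //.
move: (lebesgue_measure_itv `[p, q]) => /= ->.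
by rewrite lte_fin pq -EFinD -EFinM lee_fin leNgt mulr_gt0//; lra.
Qed.

Lemma line_integral_sq_eq0 e f : e.1 != e.2 -> edge_cont e f ->
  line_integral e (fun x => f x ^+ 2) = 0 -> forall x, segment e x -> f x = 0.
Proof.
move=> e12 cf /eqP; rewrite mulf_eq0 gt_eqF ?edist_gt0//= => /eqP i0 _ [t t01 <-].
apply/eqP; rewrite -sqrf_eq0; apply/eqP.
apply: (@Rintegral01_eq0 (fun t => f (along e t) ^+ 2)) => //.
  exact: edge_contX.
by move=> s _; exact: sqr_ge0.
Qed.

Lemma along_continuous e : continuous (along e).
Proof.
have line (a b : R) : continuous (line_path a b).
  have -> : line_path a b = fun t => t * (b - a) + a.
    by apply/funext => t; rewrite line_pathEl.
  by move=> t; apply: cvgD; [apply: cvgMl; exact: cvg_id|exact: cvg_cst].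
by move=> t; exact: (cvg_pair (line e.1.1 e.2.1 t) (line e.1.2 e.2.2 t)).
Qed.

Lemma edge_cont_within (A : set pt) e v : segment e `<=` A ->
  {within A, continuous v} -> edge_cont e v.
Proof.
move=> eA /subspace_continuousP cv; apply/subspace_continuousP => t t01.
have At : A (along e t) by apply: eA; exists t.
apply: cvg_comp (cv _ At) => P; rewrite /= !nbhs_simpl/=.
rewrite /within/= => hP.
have := @along_continuous e t _ hP; rewrite /= nbhs_simpl/=; apply: filterS => s hs s01.
by apply: hs; apply: eA; exists s.
Qed.

End EdgeIntegrals.

Section BoundaryForms.
Context {R : realType} (m : mesh R).
Local Notation pt := (plane R).

Lemma lincombE (c : R) (u v : pt -> R) x : (c *: u + v) x = c * u x + v x.
Proof. by []. Qed.

Definition bd_cont (i : 'I_(nblk m)) : set (pt -> R) :=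
  [set v | forall e, adj i e -> edge_cont (edge e) v].

Definition bd_form (i : 'I_(nblk m)) u v := bd_integral i (fun x => u x * v x).

Lemma bd_cont_subspace i : is_subspace (bd_cont i).
Proof.
split=> [e _|c u v hu hv e ie]; first exact: edge_cont_cst.
by apply: edge_contD; [apply: edge_contZ; exact: hu|exact: hv].
Qed.

Lemma bd_form_semi_inner i : semi_inner (bd_cont i) (bd_form i).
Proof.
split=> [u v _ _|c u v w hu hv hw|u hu].
- by apply: eq_bigr => e ie; congr line_integral; apply/funext => x; rewrite mulrC.
- rewrite /bd_form /bd_integral mulr_sumr -big_split/=; apply: eq_bigr => e ie.
  have huw := edge_contM (hu _ ie) (hw _ ie).
  have hvw := edge_contM (hv _ ie) (hw _ ie).
  rewrite -line_integralZ// -line_integralD//; last exact: edge_contZ.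
  by congr line_integral; apply/funext => x; rewrite mulrDl mulrA.
- by apply: sumr_ge0 => e ie; apply: line_integral_ge0 => x _; rewrite -expr2 sqr_ge0.
Qed.

Lemma bd_form_eq0 i u : bd_cont i u -> bd_form i u u = 0 ->
  forall x, boundary (blk i) x -> u x = 0.
Proof.
move=> cu; rewrite /bd_form /bd_integral => /psumr_eq0P u0 x.
rewrite boundaryE => -[e ie xe].
apply: (@line_integral_sq_eq0 _ (edge e)) => //; [exact: edge_neq|exact: cu|].
apply: u0 => //= e' _; apply: line_integral_ge0 => y _; by rewrite -expr2 sqr_ge0.
Qed.

Lemma eq_bd_integral i f g : (forall x, boundary (blk i) x -> f x = g x) ->
  @bd_integral _ m i f = bd_integral i g.
Proof.
move=> fg; apply: eq_bigr => e /adjP ie; apply: eq_line_integral => x xe.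
exact/fg/ie.
Qed.

Lemma Vh_bd_cont i : Vh i `<=` bd_cont i.
Proof.
move=> v [_ cv _] e /adjP ie; apply: edge_cont_within cv => x /ie.
exact: boundary_closure.
Qed.

Lemma trace_bd i (v : pt -> R) x : boundary (@blk _ m i) x -> trace i v x = v x.
Proof. by move=> xi; rewrite /trace patchE mem_set. Qed.

Lemma trace_off i (v : pt -> R) x : ~ boundary (@blk _ m i) x -> trace i v x = 0.
Proof. by move=> xi; rewrite /trace patchE memNset. Qed.

Lemma Vh_bd_bd_cont i : Vh_bd i `<=` bd_cont i.
Proof.
move=> _ [v hv <-] e ie; apply: edge_cont_eq (Vh_bd_cont hv ie) => x xe.
by rewrite trace_bd//; move/adjP : ie; exact.
Qed.

Lemma Vh_subspace i : is_subspace (@Vh _ m i).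
Proof.
split.
  split => //; first by move=> x; exact: cvg_cst.
  by move=> t _; exists 0, 0, 0 => x _; rewrite !mul0r !addr0.
move=> c u v [u0 cu au] [v0 cv av]; split.
- by move=> x xi; rewrite lincombE u0// v0// mulr0 addr0.
- move=> x; apply: cvgD; last exact: cv.
  by apply: cvgZr; exact: cu.
- move=> t it; have [a1 [a2 [a3 ha]]] := au _ it; have [b1 [b2 [b3 hb]]] := av _ it.
  exists (c * a1 + b1), (c * a2 + b2), (c * a3 + b3) => x xt.
  by rewrite lincombE ha// hb//; ring.
Qed.

Lemma Vh0_subspace i : is_subspace (@Vh0 _ m i).
Proof.
have [V0 VD] := Vh_subspace i; split; first by split.
move=> c u v [hu u0] [hv v0]; split; first exact: VD.
by move=> x xi; rewrite lincombE u0// v0// mulr0 addr0.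
Qed.

Lemma Vh_bd_subspace i : is_subspace (@Vh_bd _ m i).
Proof.
have [V0 VD] := Vh_subspace i; split.
  exists 0 => //; apply/funext => x.
  by rewrite /trace patchE; case: ifP.
move=> c _ _ [u hu <-] [v hv <-]; exists (c *: u + v); first exact: VD.
apply/funext => x; rewrite lincombE /trace !patchE lincombE.
by case: ifP => //; rewrite mulr0 addr0.
Qed.

End BoundaryForms.

(** * The energy form and the mass form *)

Section EnergyForm.
Context {R : realType} (m : mesh R).
Local Notation pt := (plane R).
Implicit Types (u v : pt -> R).

Lemma bounded_integrable (A : set pt) (f : pt -> R) (B : R) :
  measurable A -> (area A < +oo)%E -> measurable_fun A f ->
  (forall x, A x -> `|f x| <= B) -> area.-integrable A (EFin \o f).
Proof.
move=> mA fA mf fB; apply: measurable_bounded_integrable => //.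
exists B; split; first exact: num_real.
by move=> M BM x Ax; apply: le_trans (fB _ Ax) (ltW BM).
Qed.

Lemma Vh_measurable i v : @Vh _ m i v -> measurable_fun (@blk _ m i) v.
Proof.
move=> [_ cv _]; have cvi : {within blk i, continuous v}.
  by apply: continuous_subspaceW cv; exact: subset_closure.
move: cvi; rewrite continuous_open_subspace; last exact: blk_open.
move=> cvi; apply: (measurability _ (RGenOpens.measurableE R)).
move=> _ [_ [a [b ->] <-]]; apply: open_measurable_plane.
rewrite openE => x [xi xab]; rewrite /interior.
have bi : nbhs x (blk i) by apply: open_nbhs_nbhs; split => //; exact: blk_open.
have := cvi x (mem_set xi) _ (open_nbhs_nbhs (conj (@interval_open _ _ _ _ _) xab)).
by move=> /(_ isT isT) h; exact: filterI.
Qed.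

Lemma Vh_bounded i v : @Vh _ m i v -> exists C : R, forall x, `|v x| <= C.
Proof.
move=> [v0 _ av]; have [B hB] := closure_blk_bounded m.
have /choice[C hC] : forall t, exists C : R, in_blk i t ->
    forall x, triangle (@tri _ m t) x -> `|v x| <= C.
  move=> t; have [it|] := boolP (in_blk i t); last by exists 0.
  have [g1 [g2 [c vE]]] := av _ it; exists (`|g1| * B + `|g2| * B + `|c|) => _ x xt.
  have /hB[x1 x2] : closure (blk i) x by move/asboolP: it; exact.
  rewrite vE//; apply: le_trans (ler_normD _ _) _; rewrite lerD2r.
  by apply: le_trans (ler_normD _ _) _; rewrite !normrM lerD// ler_wpM2l.
exists (\sum_t `|C t|) => x.
have [|xi] := pselect (closure (@blk _ m i) x); last first.
  by rewrite v0// normr0; exact: sumr_ge0.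
rewrite closure_blkE => -[t it xt]; apply: le_trans (hC _ it _ xt) _.
rewrite (bigD1 t)//=; apply: le_trans (ler_norm _) _; rewrite lerDl.
exact: sumr_ge0.
Qed.

(** The extension by zero glues continuously because the trace vanishes. *)
Lemma Vh0_continuous i v : @Vh0 _ m i v -> continuous (v : pt -> R).
Proof.
move=> [[v0 /subspace_continuousP cv _] vb] y; apply/cvgrPdist_lt => e e0.
have [yi|yi] := pselect (closure (@blk _ m i) y); last first.
  have : nbhs y (~` closure (@blk _ m i)).
    by apply: open_nbhs_nbhs; split => //; exact/closed_openC/closed_closure.
  by apply: filterS => z zi; rewrite !v0// subrr normr0.
have := cv y yi; move=> /cvgrPdist_lt/(_ _ e0); rewrite near_withinE.
have [yo|yb] := pselect (blk i y).
  have : nbhs y (blk i) by apply: open_nbhs_nbhs; split => //; exact: blk_open.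
  by apply: filterS2 => z zi hz; apply: hz; exact: subset_closure.
have vy : v y = 0.
  apply: vb; split=> //; rewrite (_ : interior _ = blk i)//.
  by apply/(interior_id (blk i)).1; exact: blk_open.
apply: filterS => z hz; have [|zi] := pselect (closure (@blk _ m i) z); first exact: hz.
by rewrite vy v0// subrr normr0.
Qed.

(** A continuous function with finitely many values on a line is constant on
    it, and v vanishes far away. *)
Lemma piecewise_constant_eq0 i v : @Vh0 _ m i v ->
  (forall t, in_blk i t -> exists c, forall x, triangle (@tri _ m t) x -> v x = c) ->
  v = 0.
Proof.
move=> hv hc; apply/funext => x; apply/eqP/negPn/negP => vx.
have v0 : forall x, ~ closure (@blk _ m i) x -> v x = 0 by case: hv => -[].
have /choice[c hc'] : forall t, exists c, in_blk i t ->
    forall x, triangle (@tri _ m t) x -> v x = c.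
  by move=> t; have [/hc[c] ?|] := boolP (in_blk i t); [exists c|exists 0].
have val y : v y != 0 -> exists2 t, c t != 0 & v y = c t.
  move=> vy; have [|/v0 y0] := pselect (closure (@blk _ m i) y); last first.
    by rewrite y0 eqxx in vy.
  rewrite closure_blkE => -[t it yt]; exists t; last exact: hc' yt.
  by rewrite -(hc' _ it _ yt).
(* No value of v has an absolute value strictly between 0 and mu. *)
pose mu := \big[Num.min/`|v x|]_(t < nfine m | c t != 0) `|c t|.
have mu0 : 0 < mu by apply: lt_bigmin => [|t ct]; rewrite normr_gt0.
have mule : mu <= `|v x| by exact: bigmin_le_id.
have [B hB] := closure_blk_bounded m.
pose T : R := `|B| + `|x.1| + 1.
have T0 : 0 <= T by rewrite !addr_ge0.
pose p (r : R) : pt := (x.1 + r, x.2).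
have cp : continuous p.
  move=> r; have h : x.1 + s @[s --> r] --> x.1 + r.
    by apply: cvgD; [exact: cvg_cst|exact: cvg_id].
  exact: (cvg_pair h (cvg_cst _)).
have cs : continuous (fun r => `|v (p r)|).
  move=> r; apply: cvg_norm; apply: continuous_comp; first exact: cp.
  exact: (Vh0_continuous hv).
(* The line leaves the bounded block before the parameter T. *)
have vT : v (p T) = 0.
  apply: v0 => /hB[/= + _]; rewrite /T => h.
  have := ler_norm (x.1 + (`|B| + `|x.1| + 1)); have := ler_norm B.
  by have := ler_norm (- x.1); rewrite normrN; lra.
have p0 : p 0 = x by rewrite /p addr0; case: (x).
have [r _ hr] : exists2 r, r \in `[0, T] & `|v (p r)| = mu / 2.
  apply: (IVT T0); first exact: continuous_subspaceT.
  rewrite vT normr0 p0 min_r// max_l//; apply/andP; split; lra.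
have vr0 : v (p r) != 0 by rewrite -normr_gt0 hr; lra.
have [t ct vrt] := val _ vr0.
have : mu <= `|c t| by exact: bigmin_le_cond.
by rewrite -vrt hr; lra.
Qed.

(** The gradient is constant on a triangle and is read off at one point of its
    interior. *)
Definition center t : pt := xget (0, 0) (interior (triangle (@tri _ m t))).

Definition grad1 t v := 'D_((1, 0) : pt) v (center t).
Definition grad2 t v := 'D_((0, 1) : pt) v (center t).

Lemma center_interior t : interior (triangle (@tri _ m t)) (center t).
Proof.
have [x xt] := triangle_interior_neq0 (@tri_nondegenerate _ m t).
exact: (xgetPex (0, 0) (ex_intro _ x xt)).
Qed.

Lemma grad_affine t v (g1 g2 c : R) :
  (forall y, triangle (@tri _ m t) y -> v y = g1 * y.1 + g2 * y.2 + c) ->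
  grad1 t v = g1 /\ grad2 t v = g2.
Proof. by move=> vE; apply: derive_affine_on vE _; exact: center_interior. Qed.

Lemma grad_lincomb i t c u v : @Vh _ m i u -> @Vh _ m i v -> in_blk i t ->
  grad1 t (c *: u + v) = c * grad1 t u + grad1 t v /\
  grad2 t (c *: u + v) = c * grad2 t u + grad2 t v.
Proof.
move=> [_ _ au] [_ _ av] it.
have [a1 [a2 [a3 ha]]] := au _ it; have [b1 [b2 [b3 hb]]] := av _ it.
have [-> ->] := grad_affine ha; have [-> ->] := grad_affine hb.
apply: (@grad_affine t _ _ _ (c * a3 + b3)) => y yt.
by rewrite lincombE ha// hb//; ring.
Qed.

Section Kappa.
Variables (kappa : pt -> R) (B : R).
Hypotheses (kappa_meas : measurable_fun (dom m) kappa)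
  (kappa_le : forall x, dom m x -> kappa x <= B)
  (kappa_ge1 : forall x, dom m x -> 1 <= kappa x).

Lemma dom_measurable : measurable (dom m).
Proof. by apply: open_measurable_plane; rewrite dom_tri; exact: open_interior. Qed.

Lemma kappa_integrable (A : set pt) : measurable A -> (area A < +oo)%E ->
  A `<=` dom m -> area.-integrable A (EFin \o kappa).
Proof.
move=> mA fA Ad; apply: (@bounded_integrable _ _ B) => //.
  by apply: measurable_funS kappa_meas => //; exact: dom_measurable.
move=> x /Ad xd; have := kappa_ge1 xd; have := kappa_le xd => h1 h2.
by rewrite ger0_norm//; lra.
Qed.

Definition weight t := \int[area]_(x in interior (triangle (@tri _ m t))) kappa x.

Lemma tri_interior_measurable t : measurable (interior (triangle (@tri _ m t))).
Proof. by apply: open_measurable_plane; exact: open_interior. Qed.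

Lemma tri_interior_finite t : (area (interior (triangle (@tri _ m t))) < +oo)%E.
Proof.
have [C hC] := triangle_bounded (@tri _ m t).
apply: (@area_bounded _ _ C); first exact: tri_interior_measurable.
by move=> x /interior_subset; exact: hC.
Qed.

Lemma tri_kappa_integrable t :
  area.-integrable (interior (triangle (@tri _ m t))) (EFin \o kappa).
Proof.
apply: kappa_integrable; [exact: tri_interior_measurable|
  exact: tri_interior_finite|exact: tri_interior_dom].
Qed.

Lemma weight_gt0 t : 0 < weight t.
Proof.
have mt := tri_interior_measurable t; have ft := tri_interior_finite t.
have a0 := area_open_gt0 (open_interior _) (triangle_interior_neq0 (@tri_nondegenerate _ m t)).
apply: (@lt_le_trans _ _ (\int[area]_(x in interior (triangle (@tri _ m t))) (1 : R))).
  rewrite Rintegral_cst// mul1r; apply: fine_gt0.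
  by rewrite a0.
apply: le_Rintegral => //; first by apply: (@bounded_integrable _ _ 1) => // x _; rewrite normr1.
  exact: tri_kappa_integrable.
by move=> x /tri_interior_dom; exact: kappa_ge1.
Qed.

Lemma aKE i u v : @Vh _ m i u -> @Vh _ m i v -> aK kappa i u v =
  \sum_(t < nfine m | in_blk i t)
    weight t * (grad1 t u * grad1 t v + grad2 t u * grad2 t v).
Proof.
move=> [_ _ au] [_ _ av]; apply: eq_bigr => t it.
have [a1 [a2 [a3 ha]]] := au _ it; have [b1 [b2 [b3 hb]]] := av _ it.
have [-> ->] := grad_affine ha; have [-> ->] := grad_affine hb.
rewrite mulrC -RintegralZl//; last exact: tri_kappa_integrable.
  apply: eq_Rintegral => x /set_mem xt.
  have [-> ->] := derive_affine_on ha xt; have [-> ->] := derive_affine_on hb xt.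
  by rewrite mulrC.
exact: tri_interior_measurable.
Qed.

Lemma aK_semi_inner i : semi_inner (@Vh _ m i) (aK kappa i).
Proof.
split=> [u v hu hv|c u v w hu hv hw|u hu].
- by rewrite !aKE//; apply: eq_bigr => t _; congr (_ * _); ring.
- rewrite !aKE//; last by case: (Vh_subspace i) => _; apply.
  rewrite mulr_sumr -big_split/=; apply: eq_bigr => t it.
  by have [-> ->] := grad_lincomb c hu hv it; ring.
- rewrite aKE//; apply: sumr_ge0 => t _; rewrite mulr_ge0 ?(ltW (weight_gt0 t))//.
  by rewrite -!expr2 addr_ge0 ?sqr_ge0.
Qed.

(** Zero energy forces a zero gradient on every fine triangle. *)
Lemma aK_definite i v : @Vh0 _ m i v -> aK kappa i v v = 0 -> v = 0.
Proof.
move=> hv av0; apply: (piecewise_constant_eq0 hv) => t it.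
have [hV _] := hv; have [_ _ av] := hV.
move: av0; rewrite aKE// => /psumr_eq0P h.
have {h} : weight t * (grad1 t v * grad1 t v + grad2 t v * grad2 t v) = 0.
  apply: h => // s _; rewrite mulr_ge0 ?(ltW (weight_gt0 s))//.
  by rewrite -!expr2 addr_ge0 ?sqr_ge0.
move/eqP; rewrite mulf_eq0 (gt_eqF (weight_gt0 t))/= -!expr2.
rewrite paddr_eq0 ?sqr_ge0// !sqrf_eq0 => /andP[/eqP g10 /eqP g20].
have [g1 [g2 [c vE]]] := av _ it; have [h1 h2] := grad_affine vE.
exists c => x xt; rewrite vE//.
by move: h1 h2; rewrite g10 g20 => <- <-; rewrite !mul0r !add0r.
Qed.

Definition mass i u v := \int[area]_(x in @blk _ m i) (kappa x * u x * v x).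

Lemma mass_integrable i u v : @Vh _ m i u -> @Vh _ m i v ->
  area.-integrable (@blk _ m i) (EFin \o (fun x => kappa x * u x * v x)).
Proof.
move=> hu hv; have mi := @blk_measurable _ m i.
have mk : measurable_fun (@blk _ m i) kappa.
  by apply: measurable_funS kappa_meas; [exact: dom_measurable|exact: blk_dom].
have [C hC] := Vh_bounded hu; have [D hD] := Vh_bounded hv.
apply: (@bounded_integrable _ _ (B * C * D)) => //.
- exact: blk_finite.
- by apply: measurable_funM; [apply: measurable_funM => //|]; exact: Vh_measurable.
move=> x /blk_dom xd; have := kappa_ge1 xd; have := kappa_le xd => h1 h2.
rewrite !normrM ler_pM// ?mulr_ge0// ler_pM//.
by rewrite ger0_norm//; lra.
Qed.

Lemma mass_semi_inner i : semi_inner (@Vh _ m i) (mass i).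
Proof.
have mi := @blk_measurable _ m i.
split=> [u v _ _|c u v w hu hv hw|u hu].
- by apply: eq_Rintegral => x _; rewrite mulrAC.
- have huw := mass_integrable hu hw; have hvw := mass_integrable hv hw.
  rewrite /mass -RintegralZl// -RintegralD//.
    by apply: eq_Rintegral => x _; rewrite lincombE; ring.
  by exact: (integrableZl mi c huw).
- apply: Rintegral_ge0 => x /blk_dom xd; rewrite -mulrA mulr_ge0//.
    by apply: le_trans (kappa_ge1 xd).
  by rewrite -expr2 sqr_ge0.
Qed.

(** Young's inequality for the load, where kappa >= 1 lets the
    kappa-weighted mass dominate the plain L^2 norm of v. *)
Lemma load_block_young i (f v : pt -> R) (s : R) : 0 < s ->
  measurable_fun (dom m) f ->
  area.-integrable (dom m) (fun x => (f x ^+ 2)%:E) -> @Vh _ m i v ->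
  2 * \int[area]_(x in @blk _ m i) (f x * v x) <=
    s * \int[area]_(x in blk i) (f x ^+ 2) + s^-1 * mass i v v.
Proof.
move=> s0 mf f2 hv; have mi := @blk_measurable _ m i.
have mfi : measurable_fun (@blk _ m i) f.
  by apply: measurable_funS mf; [exact: dom_measurable|exact: blk_dom].
have mv := Vh_measurable hv.
have if2 : area.-integrable (@blk _ m i) (EFin \o (fun x => f x ^+ 2)).
  by apply: integrableS f2 => //; [exact: dom_measurable|exact: blk_dom].
have iv2 : area.-integrable (@blk _ m i) (EFin \o (fun x => v x ^+ 2)).
  have [C hC] := Vh_bounded hv; apply: (@bounded_integrable _ _ (C ^+ 2)) => //.
  - exact: blk_finite.
  - exact: measurable_funX.
  - move=> x _; rewrite normrX ler_pXn2r ?nnegrE//.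
    exact: le_trans (hC x).
have ifv : area.-integrable (@blk _ m i) (EFin \o (fun x => f x * v x)).
  apply: (@le_integrable _ _ _ _ _ mi _ (EFin \o (fun x => f x ^+ 2 + v x ^+ 2))).
  - by apply/measurable_EFinP; exact: measurable_funM.
  - move=> x _; rewrite /= lee_fin.
    rewrite [leRHS]ger0_norm; last by rewrite addr_ge0 ?sqr_ge0.
    have := sqr_ge0 (`|f x| - `|v x|); rewrite sqrrB !real_normK ?num_real// normrM.
    by have : 0 <= `|f x| * `|v x| by []; lra.
  - exact: (integrableD mi if2 iv2).
rewrite /mass -RintegralZl//.
rewrite -RintegralZl// -[X in _ + X]RintegralZl//; last exact: mass_integrable.
have isf : area.-integrable (@blk _ m i) (EFin \o (fun x => s * f x ^+ 2)).
  exact: (integrableZl mi s if2).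
have ism : area.-integrable (@blk _ m i) (EFin \o (fun x => s^-1 * (kappa x * v x * v x))).
  exact: (integrableZl mi s^-1 (mass_integrable hv hv)).
rewrite -RintegralD//; apply: le_Rintegral => //.
- exact: (integrableZl mi 2 ifv).
- exact: (integrableD mi isf ism).
move=> x /blk_dom xd; have k1 := kappa_ge1 xd.
have si0 : 0 < s^-1 by rewrite invr_gt0.
apply: (@le_trans _ _ (s * f x ^+ 2 + s^-1 * v x ^+ 2)).
  rewrite -subr_ge0 (_ : _ - _ = s^-1 * (s * f x - v x) ^+ 2); last first.
    by field; rewrite gt_eqF.
  by rewrite mulr_ge0 ?(ltW si0)// sqr_ge0.
rewrite lerD2l ler_wpM2l ?(ltW si0)// -mulrA -expr2 ler_peMl//.
exact: sqr_ge0.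
Qed.

End Kappa.
End EnergyForm.

(** * Harmonic extensions and fluxes *)

Section EigenFunctions.
Context {R : realType}.
Local Notation pt := (plane R).
Variables (S : set (pt -> R)) (a b : (pt -> R) -> (pt -> R) -> R).
Hypotheses (hS : is_subspace S) (ha : semi_inner S a) (hb : semi_inner S b).
Hypothesis ab_definite : forall v, S v -> a v v = 0 -> b v v = 0 -> v = 0.
Variables (s : R) (n : nat) (phi : nat -> pt -> R) (lam : nat -> R).
Hypotheses (s_gt0 : 0 < s) (hphi : eigenpairs S a b s n phi lam).

Lemma span_sumE k (c : nat -> R) (f : nat -> pt -> R) :
  (fun x => \sum_(j < k) c j * f j x) = \sum_(j < k) c j *: f j.
Proof. by apply/funext => x; rewrite fct_sumE. Qed.

Let phiS k : (k < n)%N -> S (phi k).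
Proof. by case: hphi => _ h _ _ /h[]. Qed.

Let phi_neq0 k : (k < n)%N -> phi k != 0.
Proof.
case: hphi => _ h _ _ /h[_ [x x0]]; apply: contra x0 => /eqP ->.
by rewrite eqxx.
Qed.

Let phi_eigen k : (k < n)%N -> forall v, S v -> a (phi k) v = lam k / s * b (phi k) v.
Proof. by case: hphi => _ _ h _; exact: h. Qed.

Let lam_lt j k : (j < k)%N -> (k < n)%N -> lam j < lam k.
Proof. by case: hphi => _ _ _; exact. Qed.

Let dimS : exists e : nat -> pt -> R,
  forall v, S v -> exists c : nat -> R, v = \sum_(k < n) c k *: e k.
Proof.
case: hphi => -[e [_ _ he]] _ _ _; exists e => v /he[c ->].
by exists c; rewrite span_sumE.
Qed.

Lemma eigenpairs_gt0 k : (k < n)%N -> 0 < b (phi k) (phi k).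
Proof. exact: (eigen_gt0 hb ab_definite phiS phi_neq0 phi_eigen). Qed.

Lemma eigenpairs_orth j k : (j < n)%N -> (k < n)%N -> j != k ->
  a (phi j) (phi k) = 0 /\ b (phi j) (phi k) = 0.
Proof.
move=> jn kn jk; split.
  exact: (eigen_ortha ha hb s_gt0 phiS phi_eigen lam_lt).
exact: (eigen_orthb ha hb s_gt0 phiS phi_eigen lam_lt).
Qed.

Lemma eigenpairs_basis v : S v ->
  exists c : nat -> R, v = \sum_(k < n) c k *: phi k.
Proof.
exact: (eigen_basis hS ha hb ab_definite s_gt0 phiS phi_neq0 phi_eigen lam_lt dimS).
Qed.

Lemma eigenpairs_tail l v : (l < n)%N -> 0 < lam l -> S v ->
  exists2 p, in_span l phi p &
    [/\ S (v - p), a v (v - p) = a (v - p) (v - p)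
      & b (v - p) (v - p) <= s / lam l * a (v - p) (v - p)].
Proof.
move=> ln l0 Sv.
have [c hc] := eigen_tail hS ha hb ab_definite s_gt0 phiS phi_neq0 phi_eigen
  lam_lt dimS ln l0 Sv.
by exists (\sum_(k < l) c k *: phi k) => //; exists c; rewrite span_sumE.
Qed.

End EigenFunctions.

(** The closing step of a Young inequality whose weight was chosen so that its
    last term is at most the quantity being bounded. *)
Lemma absorb_half (R : realDomainType) (x y z : R) :
  2 * x <= y + z -> z <= x -> x <= y.
Proof. by move=> h1 h2; lra. Qed.

Section HarmonicExtensions.
Context {R : realType} (m : mesh R).
Local Notation pt := (plane R).
Variables (kappa : pt -> R) (B : R).
Hypotheses (kappa_meas : measurable_fun (dom m) kappa)
  (kappa_le : forall x, dom m x -> kappa x <= B)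
  (kappa_ge1 : forall x, dom m x -> 1 <= kappa x).
Variable i : 'I_(nblk m).

Let aKs : semi_inner (Vh i) (aK kappa i).
Proof. exact: (aK_semi_inner kappa_meas kappa_le kappa_ge1). Qed.

Let VhS := @Vh_subspace R m i.
Let Vh0S := @Vh0_subspace R m i.

Let Vh0_Vh : Vh0 i `<=` Vh i. Proof. by move=> v []. Qed.

(** Membership without boundary data: a discrete harmonic function is the
    extension of its own trace. *)
Lemma V1snapP w : V1snap kappa i w <->
  Vh i w /\ forall z, Vh0 i z -> aK kappa i w z = 0.
Proof.
split=> [[v _ [hw _ w0]]//|[hw w0]].
exists (trace i w); first by exists w.
by split=> // x xi; rewrite trace_bd.
Qed.

Lemma V1snap_Vh : V1snap kappa i `<=` Vh i.
Proof. by move=> w /V1snapP[]. Qed.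

Lemma V1snap_subspace : is_subspace (V1snap kappa i).
Proof.
split; first by apply/V1snapP; split; [case: VhS|move=> z /Vh0_Vh hz; exact: (form0l VhS aKs)].
move=> c u v /V1snapP[hu u0] /V1snapP[hv v0]; apply/V1snapP; split.
  by case: VhS => _; exact.
move=> z hz; have hzV := Vh0_Vh hz; case: aKs => _ -> // _.
by rewrite u0// v0// mulr0 addr0.
Qed.

Definition bd_mass (p v : pt -> R) :=
  bd_integral i (fun x => kappa_tilde kappa i * p x * v x).

Lemma bd_massE p v : Vh i p -> Vh i v ->
  bd_mass p v = kappa_tilde kappa i * bd_form i p v.
Proof.
move=> /Vh_bd_cont hp /Vh_bd_cont hv; rewrite /bd_mass /bd_form /bd_integral mulr_sumr.
apply: eq_bigr => e ie; rewrite -line_integralZ; last first.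
  by apply: edge_contM; [exact: hp|exact: hv].
by congr line_integral; apply/funext => x; rewrite mulrA.
Qed.

Lemma bd_form_Vh : semi_inner (Vh i) (bd_form i).
Proof. exact: (semi_innerS (@Vh_bd_cont _ _ _) (bd_form_semi_inner _)). Qed.

Lemma bd_mass_semi_inner : semi_inner (Vh i) bd_mass.
Proof.
split=> [u v hu hv|c u v w hu hv hw|u hu].
- by rewrite !bd_massE// (formC bd_form_Vh).
- rewrite !bd_massE//; last by case: VhS => _; exact.
  by case: bd_form_Vh => _ -> // _; ring.
- rewrite bd_massE// mulr_ge0 ?(form_ge0 bd_form_Vh)//.
  exact: kappa_tilde_ge0.
Qed.

(** The weight vanishes only if the boundary has no edge. *)
Lemma kappa_tilde_eq0 (g : pt -> R) :
  kappa_tilde kappa i = 0 -> bd_integral i g = 0.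
Proof.
move=> k0; apply: big1 => e ie.
have := @kappa_bar_le _ m kappa _ _ ie; rewrite k0.
by have := kappa_bar_ge1 kappa_le kappa_ge1 e; lra.
Qed.

(** A harmonic function with zero trace is a bubble function, and the energy is
    definite on these. *)
Lemma V1snap_definite v : V1snap kappa i v ->
  aK kappa i v v = 0 -> bd_mass v v = 0 -> v = 0.
Proof.
move=> /V1snap_Vh hv av0; rewrite bd_massE// => /eqP; rewrite mulf_eq0 => bv0.
have {}bv0 : bd_form i v v = 0.
  by case/orP: bv0 => /eqP//; exact: kappa_tilde_eq0.
apply: (aK_definite kappa_meas kappa_le kappa_ge1 _ av0); split=> //.
by apply: bd_form_eq0 bv0; exact: Vh_bd_cont.
Qed.

Lemma Vh0_definite v : V2snap i v -> aK kappa i v v = 0 -> mass kappa i v v = 0 -> v = 0.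
Proof. by move=> hv av0 _; exact: (aK_definite kappa_meas kappa_le kappa_ge1 hv av0). Qed.

Variables (M1 M2 : nat) (phi xi : nat -> pt -> R) (lam1 lam2 : nat -> R).
Hypotheses (hphi : eigenpairs1 kappa i M1 phi lam1)
  (hxi : eigenpairs2 kappa i M2 xi lam2).

Let H_gt0 : 0 < coarse_size m. Proof. exact: coarse_size_gt0. Qed.
Let H2_gt0 : 0 < coarse_size m ^+ 2. Proof. exact: exprn_gt0. Qed.

Let aK1 : semi_inner (V1snap kappa i) (aK kappa i).
Proof. exact: semi_innerS V1snap_Vh aKs. Qed.
Let aK2 : semi_inner (V2snap i) (aK kappa i).
Proof. exact: semi_innerS Vh0_Vh aKs. Qed.
Let b1 : semi_inner (V1snap kappa i) bd_mass.
Proof. exact: semi_innerS V1snap_Vh bd_mass_semi_inner. Qed.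
Let b2 : semi_inner (V2snap i) (mass kappa i).
Proof.
exact: semi_innerS Vh0_Vh (mass_semi_inner kappa_meas kappa_le kappa_ge1 i).
Qed.

(** The energy-orthogonal projection onto V_h^0, computed in the basis of the
    interior eigenfunctions. *)
Lemma harmonic_ext_exists z : Vh i z -> exists w, harmonic_ext kappa i z w.
Proof.
move=> hz.
have xiS k : (k < M2)%N -> Vh0 i (xi k) by case: hxi => _ h _ _ /h[].
have axi k : (k < M2)%N -> aK kappa i (xi k) (xi k) != 0.
  move=> kM; apply/eqP => a0; have [_ h _ _] := hxi.
  have [_ [x]] := h _ kM.
  by rewrite (aK_definite kappa_meas kappa_le kappa_ge1 (xiS _ kM) a0) eqxx.
pose d k := aK kappa i z (xi k) / aK kappa i (xi k) (xi k).
have xiV (k : 'I_M2) : Vh i (xi k) by apply/Vh0_Vh/xiS.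
pose p := \sum_(k < M2) d k *: xi k.
have hp : Vh0 i p by apply: subspace_sum => // k; apply: subspaceZ => //; exact: xiS.
have hpV := Vh0_Vh hp; have hw := subspaceB VhS hz hpV.
exists (z - p); split=> //.
  by move=> x xi'; case: hp => _ /(_ _ xi') px; rewrite -[LHS]/(z x - p x) px subr0.
move=> y hy; have [c ->] := eigenpairs_basis Vh0S aK2 b2 Vh0_definite H2_gt0 hxi hy.
rewrite (form_sumr VhS aKs)//; last by move=> k; exact: subspaceZ.
apply: big1 => j _; rewrite (formZr VhS aKs)// (formBl VhS aKs)//.
rewrite (form_suml VhS aKs)//; last by move=> k; exact: subspaceZ.
rewrite (bigD1 j)//= (formZl VhS aKs)// big1 ?addr0.
  by rewrite /d divfK ?axi// subrr mulr0.
move=> k kj; rewrite (formZl VhS aKs)//.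
have [-> _] := eigenpairs_orth aK2 b2 H2_gt0 hxi (ltn_ord k) (ltn_ord j) kj.
by rewrite mulr0.
Qed.

(** Riesz representation in the basis of the boundary eigenfunctions. *)
Lemma flux_exists u : Vh i u -> is_flux kappa i u (flux kappa i u).
Proof.
move=> hu; rewrite /flux; suff [q hq] : exists q, is_flux kappa i u q.
  exact: (xgetPex _ (ex_intro (fun q => [set q | is_flux kappa i u q] q) q hq)).
have phiS k : (k < M1)%N -> V1snap kappa i (phi k) by case: hphi => _ h _ _ /h[].
have phiV (k : 'I_M1) : Vh i (phi k) by apply/V1snap_Vh/phiS.
pose beta k := bd_form i (phi k) (phi k).
have beta0 k : (k < M1)%N -> beta k != 0.
  move=> kM; apply/eqP => bk.
  have := eigenpairs_gt0 b1 V1snap_definite hphi kM.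
  rewrite bd_massE; [|exact/V1snap_Vh/phiS..].
  by rewrite [bd_form _ _ _]bk mulr0 ltxx.
have borth (j k : 'I_M1) : j != k -> bd_form i (phi j) (phi k) = 0.
  move=> jk; have [_] := eigenpairs_orth aK1 b1 H_gt0 hphi (ltn_ord j) (ltn_ord k) jk.
  rewrite -/(bd_mass _ _) bd_massE// => /eqP; rewrite mulf_eq0 => /orP[/eqP|/eqP//].
  exact: kappa_tilde_eq0.
pose r := \sum_(k < M1) (aK kappa i u (phi k) / beta k) *: phi k.
have rV : Vh i r by apply: subspace_sum => // k; exact: subspaceZ.
exists (trace i r); split; first by exists r.
move=> v w hv hw; have [hwV wv _] := hw.
have w1 : V1snap kappa i w by exists v.
transitivity (bd_form i r w).
  by apply: eq_bd_integral => x xi'; rewrite trace_bd// wv.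
have [c wE] := eigenpairs_basis V1snap_subspace aK1 b1 V1snap_definite H_gt0 hphi w1.
have bV := bd_form_Vh.
rewrite wE (form_sumr VhS aKs)//; last by move=> k; exact: subspaceZ.
rewrite (form_sumr VhS bV)//; last by move=> k; exact: subspaceZ.
apply: eq_bigr => j _; rewrite (formZr VhS aKs)// (formZr VhS bV)//; congr (_ * _).
rewrite (form_suml VhS bV)//; last by move=> k; exact: subspaceZ.
rewrite (bigD1 j)//= (formZl VhS bV)// big1 ?addr0; first by rewrite divfK ?beta0.
by move=> k kj; rewrite (formZl VhS bV)// borth// mulr0.
Qed.

Lemma flux_Vh_bd u : Vh i u -> Vh_bd i (flux kappa i u).
Proof. by case/flux_exists. Qed.

Lemma is_flux_form u q w : is_flux kappa i u q -> V1snap kappa i w ->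
  bd_form i q w = aK kappa i u w.
Proof.
move=> [hq h] [v hv hw]; rewrite -(h v w hv hw); apply: eq_bd_integral => x xi'.
by have [_ wv _] := hw; rewrite wv.
Qed.

Lemma harmonic_ext_trace z : Vh i z -> exists2 w, V1snap kappa i w &
  forall x, boundary (blk i) x -> w x = z x.
Proof.
move=> hz; have [w hw] := harmonic_ext_exists hz; have [hwV wz w0] := hw.
exists w; [exact/V1snapP|exact: wz].
Qed.

(** The difference of two fluxes of u is orthogonal on the boundary to every
    trace, hence to itself. Uniqueness makes the flux linear in u, without
    which a_DG would not be bilinear. *)
Lemma is_flux_unique u q q' : is_flux kappa i u q -> is_flux kappa i u q' -> q = q'.
Proof.
move=> hq hq'; have hr := subspaceB (@Vh_bd_subspace R m i) hq.1 hq'.1.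
have [z hz rz] := hr; have [w hw wz] := harmonic_ext_trace hz.
have bS := bd_cont_subspace i; have bF := bd_form_semi_inner i.
have cq := Vh_bd_bd_cont hq.1; have cq' := Vh_bd_bd_cont hq'.1.
have cw := Vh_bd_cont (V1snap_Vh hw).
have r0 : bd_form i (q - q') (q - q') = 0.
  transitivity (bd_form i (q - q') w).
    apply: eq_bd_integral => x xi'; rewrite wz//; congr (_ * _).
    by rewrite -rz trace_bd.
  by rewrite (formBl bS bF)// (is_flux_form hq)// (is_flux_form hq')// subrr.
apply/funext => x; have [xi'|xi'] := pselect (boundary (blk i) x); last first.
  by case: hq.1 => z1 _ <-; case: hq'.1 => z2 _ <-; rewrite !trace_off.
have := bd_form_eq0 (subspaceB bS cq cq') r0 xi'.
by rewrite -[LHS]/(q x - q' x) => /eqP; rewrite subr_eq0 => /eqP.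
Qed.

Lemma flux_lincomb c u v : Vh i u -> Vh i v ->
  flux kappa i (c *: u + v) = c *: flux kappa i u + flux kappa i v.
Proof.
move=> hu hv; have huv : Vh i (c *: u + v) by case: VhS => _; exact.
apply: (is_flux_unique (flux_exists huv)).
have fu := flux_exists hu; have fv := flux_exists hv.
split; first by case: (@Vh_bd_subspace R m i) => _; apply; [case: fu|case: fv].
move=> z w hz hw; have w1 : V1snap kappa i w by exists z.
have hwV := V1snap_Vh w1.
transitivity (bd_form i (c *: flux kappa i u + flux kappa i v) w).
  by apply: eq_bd_integral => x xi'; have [_ wv _] := hw; rewrite wv.
have [_ bl _] := bd_form_semi_inner i; have [_ al _] := aKs.
rewrite bl ?al//; last 3 first.
- by apply: Vh_bd_bd_cont; case: fu.
- by apply: Vh_bd_bd_cont; case: fv.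
- exact: Vh_bd_cont.
have e1 := is_flux_form fu w1; have e2 := is_flux_form fv w1.
exact: (f_equal2 (fun x y => c * x + y) e1 e2).
Qed.

(** Test the flux against its own harmonic extension and apply the inverse
    inequality to the latter. *)
Lemma flux_bound (Cinv : R) u : 0 < Cinv -> inverse_inequality m kappa Cinv ->
  Vh i u ->
  bd_form i (flux kappa i u) (flux kappa i u) <=
  kappa_blk kappa i * Cinv ^+ 2 / fine_size m * aK kappa i u u.
Proof.
move=> C0 hinv hu; move: (flux_exists hu); move: (flux kappa i u) => q fu.
set s := kappa_blk kappa i * Cinv ^+ 2 / fine_size m.
have h0 := fine_size_gt0 m.
have k1 : 1 <= kappa_blk kappa i by exact: (kappa_blk_ge1 kappa_le kappa_ge1).
have s0 : 0 < s by rewrite /s divr_gt0// mulr_gt0 ?exprn_gt0//; lra.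
have [z hz qz] := fu.1; have [w hw] := harmonic_ext_exists hz.
have hqw : harmonic_ext kappa i q w.
  by have [h1 h2 h3] := hw; split=> // x xi'; rewrite h2// -qz trace_bd.
have hwV : Vh i w by case: hw.
have e1 : bd_form i q q = aK kappa i u w by apply: (fu.2 q w fu.1 hqw).
have e2 := hinv i q w fu.1 hqw; rewrite -/s in e2.
have e3 := form_young VhS aKs s0 hu hwV.
have e4 : s^-1 * aK kappa i w w <= bd_form i q q.
  rewrite mulrC ler_pdivrMr// mulrC; apply: (le_trans e2); rewrite le_eqVlt; apply/orP; left.
  by apply/eqP; congr (_ * _); apply: eq_bigr => e _; congr line_integral; apply/funext => x; rewrite expr2.
by apply: absorb_half e4; rewrite e1.
Qed.

(** The eigenfunctions discarded from u1: their energy is a boundary pairing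
    with the flux of u1, which the spectral gap turns into a bound by the
    squared norm of the flux. *)
Lemma V1_tail l u1 : (l < M1)%N -> 0 < lam1 l -> V1snap kappa i u1 ->
  let T := coarse_size m / (kappa_tilde kappa i * lam1 l) *
           bd_integral i (fun x => flux kappa i u1 x ^+ 2) in
  exists2 p, in_span l phi p &
    [/\ V1snap kappa i (u1 - p), aK kappa i (u1 - p) (u1 - p) <= T
      & kappa_tilde kappa i * bd_form i (u1 - p) (u1 - p) <=
        coarse_size m / lam1 l * T].
Proof.
move=> lM l0 h1 T.
have [p hp [he ae be]] :=
  eigenpairs_tail V1snap_subspace aK1 b1 V1snap_definite H_gt0 hphi lM l0 h1.
have heV := V1snap_Vh he; have h1V := V1snap_Vh h1.
exists p; first exact: hp.
set e := u1 - p in he ae be heV *.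
have {}be : kappa_tilde kappa i * bd_form i e e <=
    coarse_size m / lam1 l * aK kappa i e e.
  by rewrite -(bd_massE heV heV); exact: be.
move: (flux_exists h1V) @T; move: (flux kappa i u1) => q f1 T.
have qe : bd_form i q e = aK kappa i e e by rewrite (is_flux_form f1).
have bS := bd_cont_subspace i; have bF := bd_form_semi_inner i.
have TE : T = coarse_size m / (kappa_tilde kappa i * lam1 l) * bd_form i q q.
  by congr (_ * _); apply: eq_bigr => ? _; congr line_integral; apply/funext => x; rewrite expr2.
have aT : aK kappa i e e <= T.
  have k0 := @kappa_tilde_ge0 _ m kappa i.
  have [kz|kn] := eqVneq (kappa_tilde kappa i) 0.
    have -> : aK kappa i e e = 0 := etrans (esym qe) (kappa_tilde_eq0 _ kz).
    by rewrite TE kz mul0r invr0 mulr0 mul0r.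
  have kp : 0 < kappa_tilde kappa i by rewrite lt_def kn.
  have [t [t0 tE tV]] : exists t, [/\ 0 < t, T = t * bd_form i q q &
      t^-1 = kappa_tilde kappa i * (lam1 l / coarse_size m)].
    exists (coarse_size m / (kappa_tilde kappa i * lam1 l)); split; last 2 first.
    - exact: TE.
    - by field; rewrite !gt_eqF.
    - exact: (divr_gt0 H_gt0 (mulr_gt0 kp l0)).
  have yT : 2 * aK kappa i e e <= T + t^-1 * bd_form i e e.
    rewrite tE -{1}qe.
    exact: (form_young bS bF t0 (Vh_bd_bd_cont f1.1) (Vh_bd_cont heV)).
  have bt : t^-1 * bd_form i e e <= aK kappa i e e.
    rewrite tV; move: be; move: (aK kappa i e e) (bd_form i e e) => x y be.
    have -> : kappa_tilde kappa i * (lam1 l / coarse_size m) * y =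
        lam1 l / coarse_size m * (kappa_tilde kappa i * y) by ring.
    rewrite -ler_pdivlMl; last exact: (divr_gt0 l0 H_gt0).
    by rewrite invf_div.
  exact: absorb_half yT bt.
split; [exact: he|exact: aT|].
apply: (le_trans be); apply: ler_wpM2l aT.
exact: (ltW (divr_gt0 H_gt0 l0)).
Qed.

Lemma V2_tail l u : (l < M2)%N -> 0 < lam2 l -> Vh0 i u ->
  exists2 p, in_span l xi p &
    [/\ Vh0 i (u - p), aK kappa i u (u - p) = aK kappa i (u - p) (u - p)
      & mass kappa i (u - p) (u - p) <=
        coarse_size m ^+ 2 / lam2 l * aK kappa i (u - p) (u - p)].
Proof. exact: (eigenpairs_tail Vh0S aK2 b2 Vh0_definite H2_gt0 hxi). Qed.

Lemma span1_Vh l p : (l < M1)%N -> in_span l phi p -> Vh i p.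
Proof.
move=> lM [c ->]; rewrite span_sumE; apply: subspace_sum => // k.
apply: subspaceZ => //; case: hphi => _ h _ _.
by apply: V1snap_Vh; apply h; exact: ltn_trans lM.
Qed.

Lemma span2_Vh l p : (l < M2)%N -> in_span l xi p -> Vh0 i p.
Proof.
move=> lM [c ->]; rewrite span_sumE; apply: subspace_sum => // k.
apply: subspaceZ => //; case: hxi => _ h _ _.
by apply h; exact: ltn_trans lM.
Qed.

End HarmonicExtensions.

(** * The discontinuous Galerkin form *)

(** The weight 2 / (g + c) lies strictly between 1 / g and 1 / c, so that the
    form and the norm absorb the term T on both sides. *)
Lemma penalty_absorbs (R : realType) (g c A J T : R) (t := 2 / (g + c)) :
  0 <= c -> c < g -> 0 <= A -> 0 <= J ->
  2 * `|T| <= t * c * A + t^-1 * J ->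
  (g - c) / (2 * g) * (A + g * J) <= A - (T + T) + g * J <= 2 * (A + g * J).
Proof.
move=> c0 cg A0 J0; have gc0 : 0 < g + c by lra.
have g0 : 0 < g by lra.
have -> : t^-1 = (g + c) / 2 by rewrite invf_div.
have := ler_norm T; have := ler_norm (- T); rewrite normrN => T1 T2 hT.
have e1 : (g - c) / (2 * g) * (A + g * J) =
    (g - c) / (2 * g) * A + (g - c) / 2 * J by field; rewrite gt_eqF.
have e2 : (g - c) / (2 * g) * A <= (1 - t * c) * A.
  rewrite ler_wpM2r// (_ : 1 - t * c = (g - c) / (g + c)); last first.
    by rewrite /t; field; rewrite gt_eqF.
  by rewrite ler_wpM2l ?lef_pV2 ?posrE; lra.
have e3 : t * c * A <= 1 * A.
  by rewrite ler_wpM2r// /t mulrAC ler_pdivrMr//; lra.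
have e4 : (g + c) / 2 * J <= g * J by rewrite ler_wpM2r//; lra.
by apply/andP; split; [rewrite e1|]; lra.
Qed.

Section DGForm.
Context {R : realType} (m : mesh R).
Local Notation pt := (plane R).
Variables (kappa : pt -> R) (B : R).
Hypotheses (kappa_meas : measurable_fun (dom m) kappa)
  (kappa_le : forall x, dom m x -> kappa x <= B)
  (kappa_ge1 : forall x, dom m x -> 1 <= kappa x).
Variable Cinv : R.
Hypotheses (flux_bd : forall (i : 'I_(nblk m)) u, Vh i u -> Vh_bd i (flux kappa i u))
  (flux_linear : forall (i : 'I_(nblk m)) c u v, Vh i u -> Vh i v ->
    flux kappa i (c *: u + v) = c *: flux kappa i u + flux kappa i v)
  (flux_le : forall (i : 'I_(nblk m)) u, Vh i u ->
    bd_form i (flux kappa i u) (flux kappa i u) <=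
    kappa_blk kappa i * Cinv ^+ 2 / fine_size m * aK kappa i u u).
Implicit Types u v w : broken m.
Local Opaque aK flux line_integral fine_size kappa_blk.

Let h_gt0 : 0 < fine_size m. Proof. exact: fine_size_gt0. Qed.
Let aKs (i : 'I_(nblk m)) : semi_inner (Vh i) (aK kappa i).
Proof. exact: (aK_semi_inner kappa_meas kappa_le kappa_ge1). Qed.
Let kblk_gt0 i : 0 < kappa_blk (m := m) kappa i.
Proof. by have := kappa_blk_ge1 kappa_le kappa_ge1 i; lra. Qed.
Let kbar_gt0 e : 0 < kappa_bar (m := m) kappa e.
Proof. by have := kappa_bar_ge1 kappa_le kappa_ge1 e; lra. Qed.

Lemma VDG_subspace : is_subspace (@VDG _ m).
Proof.
split=> [i|c u v hu hv i]; first by case: (@Vh_subspace _ m i).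
by case: (@Vh_subspace _ m i) => _; apply; [exact: hu|exact: hv].
Qed.

Lemma aH_semi_inner : semi_inner (@VDG _ m) (aH kappa).
Proof.
split=> [u v hu hv|c u v w hu hv hw|u hu].
- by apply: eq_bigr => i _; rewrite (formC (aKs i)).
- rewrite /aH mulr_sumr -big_split; apply: eq_bigr => i _.
  by case: (aKs i) => _ h _; exact: h.
- by apply: sumr_ge0 => i _; exact: (form_ge0 (aKs i)).
Qed.

Lemma jump_lincomb e c u v x :
  jump e (c *: u + v) x = c * jump e u x + jump e v x.
Proof.
rewrite /jump; case: (eminus e) => [j|//].
rewrite (_ : (c *: u + v) (eplus e) x = c * u (eplus e) x + v (eplus e) x)//.
by rewrite (_ : (c *: u + v) j x = c * u j x + v j x)//; ring.
Qed.

Definition flux_avg e u x := avg e (edge_flux kappa e u) x.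

Lemma flux_avg_lincomb e c u v x : VDG u -> VDG v ->
  flux_avg e (c *: u + v) x = c * flux_avg e u x + flux_avg e v x.
Proof.
move=> hu hv; rewrite /flux_avg /avg /edge_flux eqxx.
have fl i : flux kappa i ((c *: u + v) i) x =
    c * flux kappa i (u i) x + flux kappa i (v i) x.
  by rewrite (_ : (c *: u + v) i = c *: u i + v i)// flux_linear.
case: (eminus e) => [j|]; last exact: fl.
rewrite (fl (eplus e)) (fl j).
move: (flux _ (eplus e) (u _) x) (flux _ (eplus e) (v _) x).
move: (flux _ j (u _) x) (flux _ j (v _) x) => a b a' b'.
by case: ifP => _; field.
Qed.

Lemma jump_cont e u : VDG u -> edge_cont (edge e) (jump e u).
Proof.
move=> hu; have hi i : adj i e -> edge_cont (edge e) (u i).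
  exact: (Vh_bd_cont (hu i)).
rewrite /jump; case ej : (eminus e) => [j|]; last exact/hi/adj_eplus.
by apply: edge_contD; [exact/hi/adj_eplus|apply: edge_contN; exact/hi/adj_eminus].
Qed.

Let flux_cont i e u : VDG u -> adj i e -> edge_cont (edge e) (flux kappa i (u i)).
Proof. by move=> hu; exact: (Vh_bd_bd_cont (flux_bd (hu i))). Qed.

Lemma flux_avg_cont e u : VDG u -> edge_cont (edge e) (flux_avg e u).
Proof.
move=> hu; rewrite /flux_avg /avg /edge_flux eqxx.
case ej : (eminus e) => [j|]; last exact/(flux_cont hu)/adj_eplus.
rewrite (eminus_neq ej).
apply: edge_contM; last exact: edge_cont_cst.
apply: edge_contD; first exact/(flux_cont hu)/adj_eplus.
by apply: edge_contN; exact/(flux_cont hu)/adj_eminus.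
Qed.

(** Kept free of the penalty parameter, since the final estimate contains it
    with the factor Cinv^2 instead of gamma. *)
Definition jump_form u v := \sum_(e < nedge m) (fine_size m)^-1 *
  line_integral (edge e) (fun x => kappa_bar kappa e * jump e u x * jump e v x).

Definition consistency u v := \sum_(e < nedge m)
  line_integral (edge e) (fun x => flux_avg e u x * jump e v x).

Let jj_cont e u v : VDG u -> VDG v ->
  edge_cont (edge e) (fun x => kappa_bar kappa e * jump e u x * jump e v x).
Proof.
move=> hu hv; apply: edge_contM; last exact: jump_cont.
by apply: edge_contZ; exact: jump_cont.
Qed.

Let fj_cont e u v : VDG u -> VDG v ->
  edge_cont (edge e) (fun x => flux_avg e u x * jump e v x).
Proof. by move=> hu hv; apply: edge_contM; [exact: flux_avg_cont|exact: jump_cont]. Qed.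

Lemma jump_form_semi_inner : semi_inner (@VDG _ m) jump_form.
Proof.
split=> [u v hu hv|c u v w hu hv hw|u hu].
- apply: eq_bigr => e _; congr (_ * line_integral _ _).
  by apply/funext => x; rewrite mulrAC.
- rewrite /jump_form mulr_sumr -big_split; apply: eq_bigr => e _ /=.
  rewrite [RHS](_ : _ = (fine_size m)^-1 * (c * line_integral (edge e)
      (fun x => kappa_bar kappa e * jump e u x * jump e w x) +
    line_integral (edge e) (fun x => kappa_bar kappa e * jump e v x * jump e w x))).
    congr (_ * _); rewrite -line_integralZ; last exact: jj_cont.
    rewrite -line_integralD; [|by apply: edge_contZ; exact: jj_cont|exact: jj_cont].
    congr line_integral; apply/funext => x; rewrite jump_lincomb.
    by move: (jump e u x) (jump e v x) (jump e w x) => *; ring.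
  by move: (line_integral _ _) (line_integral _ _) => *; ring.
- apply: sumr_ge0 => e _; rewrite mulr_ge0// ?invr_ge0 ?(ltW h_gt0)//.
  apply: line_integral_ge0 => x _; rewrite -mulrA -expr2 mulr_ge0 ?sqr_ge0//.
  exact: ltW.
Qed.

Lemma consistency_linl c u v w : VDG u -> VDG v -> VDG w ->
  consistency (c *: u + v) w = c * consistency u w + consistency v w.
Proof.
move=> hu hv hw; rewrite /consistency mulr_sumr -big_split; apply: eq_bigr => e _ /=.
rewrite -line_integralZ; last exact: fj_cont.
rewrite -line_integralD; [|by apply: edge_contZ; exact: fj_cont|exact: fj_cont].
congr line_integral; apply/funext => x.
rewrite flux_avg_lincomb//.
by move: (flux_avg e u x) (flux_avg e v x) => *; ring.
Qed.

Lemma consistency_linr c u v w : VDG u -> VDG v -> VDG w ->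
  consistency w (c *: u + v) = c * consistency w u + consistency w v.
Proof.
move=> hu hv hw; rewrite /consistency mulr_sumr -big_split; apply: eq_bigr => e _ /=.
rewrite -line_integralZ; last exact: fj_cont.
rewrite -line_integralD; [|by apply: edge_contZ; exact: fj_cont|exact: fj_cont].
congr line_integral; apply/funext => x.
rewrite jump_lincomb; move: (jump e u x) (jump e v x) => *; ring.
Qed.

(** On an interior edge, Cauchy-Schwarz with the weights k and l gives
    (p - q)^2 <= (p^2 / k + q^2 / l) (k + l), and k + l is twice kappa_bar: the
    arithmetic mean in the penalty is what matches the two block
    coefficients. *)
Lemma flux_avg_sq e u x : flux_avg e u x ^+ 2 / kappa_bar kappa e <=
  flux kappa (eplus e) (u (eplus e)) x ^+ 2 / kappa_blk kappa (eplus e) +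
  (if eminus e is Some j then flux kappa j (u j) x ^+ 2 / kappa_blk kappa j else 0).
Proof.
rewrite /flux_avg /avg /edge_flux eqxx /kappa_bar.
case ej : (eminus e) => [j|]; last by rewrite addr0.
rewrite (eminus_neq ej); set p := flux _ _ _ _; set q := flux _ _ _ _.
have := kblk_gt0 (eplus e); have := kblk_gt0 j.
set k := kappa_blk _ _; set l := kappa_blk _ _ => k0 l0.
have d0 : 0 < k * l * (k + l) by rewrite !mulr_gt0// addr_gt0.
rewrite -subr_ge0.
have -> : p ^+ 2 / l + q ^+ 2 / k - ((p - q) / 2) ^+ 2 / ((l + k) / 2) =
    ((k * p + l * q) ^+ 2 + (k + l) * (k * p ^+ 2 + l * q ^+ 2)) / 2 /
    (k * l * (k + l)).
  by field; rewrite ?gt_eqF// addr_gt0.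
apply: divr_ge0; last exact: ltW.
apply: divr_ge0 => //; apply: addr_ge0; first exact: sqr_ge0.
have k1 := ltW k0; have l1 := ltW l0.
by apply: mulr_ge0; apply: addr_ge0 => //; apply: mulr_ge0 => //; exact: sqr_ge0.
Qed.

(** The coefficient of each block cancels between the flux bound and the weight
    1 / kappa_bar, so the constant is independent of the contrast of kappa. *)
Lemma flux_avg_energy u : VDG u ->
  fine_size m * (\sum_(e < nedge m)
    line_integral (edge e) (fun x => flux_avg e u x ^+ 2 / kappa_bar kappa e)) <=
  Cinv ^+ 2 * aH kappa u u.
Proof.
move=> hu.
pose F i e := line_integral (@edge _ m e)
  (fun x => flux kappa i (u i) x ^+ 2 / kappa_blk kappa i).
have FE i : \sum_(e < nedge m | adj i e) F i e =
    (kappa_blk kappa i)^-1 * bd_form i (flux kappa i (u i)) (flux kappa i (u i)).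
  rewrite /bd_form /bd_integral mulr_sumr; apply: eq_bigr => e ie.
  have cf := flux_cont hu ie; rewrite -line_integralZ; last exact: edge_contM.
  by congr line_integral; apply/funext => x; rewrite mulrC expr2.
apply: (@le_trans _ _ (fine_size m * \sum_(i < nblk m) \sum_(e < nedge m | adj i e) F i e)).
  rewrite ler_wpM2l ?(ltW h_gt0)// sum_adj; apply: ler_sum => e _.
  have cF i : adj i e -> edge_cont (edge e)
      (fun x => flux kappa i (u i) x ^+ 2 / kappa_blk kappa i).
    move=> ie; apply: edge_contM; last exact: edge_cont_cst.
    exact/edge_contX/flux_cont.
  have ca : edge_cont (edge e) (fun x => flux_avg e u x ^+ 2 / kappa_bar kappa e).
    apply: edge_contM; last exact: edge_cont_cst.
    exact/edge_contX/flux_avg_cont.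
  have := @flux_avg_sq e u; case ej : (eminus e) => [j|] hsq.
    rewrite -line_integralD; [|exact/cF/adj_eplus|exact/cF/adj_eminus].
    apply: le_line_integral => //.
    by apply: edge_contD; [exact/cF/adj_eplus|exact/cF/adj_eminus].
  rewrite addr0; apply: le_line_integral => //; first exact/cF/adj_eplus.
  by move=> x _; rewrite -[leRHS]addr0.
rewrite mulr_sumr /aH mulr_sumr; apply: ler_sum => i _; rewrite FE.
have k0 := kblk_gt0 i.
rewrite mulrA -ler_pdivlMl ?divr_gt0//; apply: (le_trans (flux_le (hu i))).
rewrite le_eqVlt; apply/orP; left; apply/eqP; field.
by rewrite !gt_eqF.
Qed.

(** The free weight t is tuned in two ways: for coercivity it balances gamma
    against Cinv^2, and for the bubble part of the error it makes the flux term
    absorbable. *)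
Lemma consistency_young (t : R) u v : 0 < t -> VDG u -> VDG v ->
  2 * consistency u v <= t * Cinv ^+ 2 * aH kappa u u + t^-1 * jump_form v v.
Proof.
move=> t0 hu hv.
apply: (@le_trans _ _ (t * (fine_size m * (\sum_(e < nedge m)
    line_integral (edge e) (fun x => flux_avg e u x ^+ 2 / kappa_bar kappa e))) +
    t^-1 * jump_form v v)); last first.
  by rewrite lerD2r -mulrA ler_wpM2l ?(ltW t0)// flux_avg_energy.
rewrite /consistency /jump_form !mulr_sumr -big_split; apply: ler_sum => e _ /=.
have ca : edge_cont (edge e) (fun x => flux_avg e u x ^+ 2 / kappa_bar kappa e).
  apply: edge_contM; last exact: edge_cont_cst.
  exact/edge_contX/flux_avg_cont.
have cj := @jj_cont e v v hv hv; have cf := @fj_cont e u v hu hv.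
rewrite (mulrA t) (mulrA t^-1) -(line_integralZ _ cf) -(line_integralZ _ ca) -(line_integralZ _ cj).
rewrite -line_integralD; [|exact: edge_contZ..].
apply: le_line_integral; [exact: edge_contZ|by apply: edge_contD; exact: edge_contZ|].
move=> x _; set a := flux_avg e u x; set b := jump e v x.
have := kbar_gt0 e; set k := kappa_bar _ _ => k0.
rewrite -subr_ge0 (_ : _ - _ =
  (t * fine_size m * a - k * b) ^+ 2 / (t * fine_size m * k)); last first.
  by field; rewrite !gt_eqF.
by rewrite divr_ge0 ?sqr_ge0// ltW// !mulr_gt0.
Qed.

Lemma consistency_abs_young (t : R) u v : 0 < t -> VDG u -> VDG v ->
  2 * `|consistency u v| <= t * Cinv ^+ 2 * aH kappa u u + t^-1 * jump_form v v.
Proof.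
move=> t0 hu hv; have hnv : VDG (-1 *: v) by exact: (subspaceZ _ VDG_subspace).
have := consistency_young t0 hu hv; have := consistency_young t0 hu hnv.
have V0 : VDG (0 : broken m) by case: VDG_subspace.
have Z : consistency u 0 = 0.
  by have := consistency_linr 1 V0 V0 hu; rewrite scale1r addr0 mul1r; lra.
have -> : consistency u (-1 *: v) = - consistency u v.
  by have := consistency_linr (-1) hv V0 hu; rewrite addr0 Z; lra.
rewrite (formZl VDG_subspace jump_form_semi_inner)//.
rewrite (formZr VDG_subspace jump_form_semi_inner)//.
by rewrite mulN1r mulN1r opprK; case: ler0P => _; lra.
Qed.

Lemma aDGE gamma u v : VDG u -> VDG v -> aDG kappa gamma u v =
  aH kappa u v - (consistency u v + consistency v u) + gamma * jump_form u v.
Proof.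
move=> hu hv; rewrite /aDG; congr (_ - _ + _).
  rewrite /consistency -big_split; apply: eq_bigr => e _ /=.
  by rewrite -line_integralD; [|exact: fj_cont..].
by rewrite /jump_form mulr_sumr; apply: eq_bigr => e _; rewrite (mulrA gamma).
Qed.

Lemma normDG_sqE gamma u : normDG_sq kappa gamma u =
  aH kappa u u + gamma * jump_form u u.
Proof.
rewrite /normDG_sq; congr (_ + _); rewrite /jump_form mulr_sumr.
apply: eq_bigr => e _; rewrite (mulrA gamma); congr (_ * line_integral _ _).
by apply/funext => x; rewrite expr2 mulrA.
Qed.

Section Penalty.
Variable gamma : R.
Hypotheses (gamma_gt0 : 0 < gamma) (Cinv_lt : Cinv ^+ 2 < gamma).

Lemma aDG_equiv u : VDG u ->
  (gamma - Cinv ^+ 2) / (2 * gamma) * normDG_sq kappa gamma u <=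
    aDG kappa gamma u u <= 2 * normDG_sq kappa gamma u.
Proof.
move=> hu; rewrite normDG_sqE aDGE//; apply: penalty_absorbs => //.
- exact: sqr_ge0.
- exact: (form_ge0 aH_semi_inner).
- exact: (form_ge0 jump_form_semi_inner).
apply: consistency_abs_young => //; rewrite divr_gt0//.
exact: ltr_wpDr (sqr_ge0 _) gamma_gt0.
Qed.

Lemma aDG_coercive u : VDG u ->
  (gamma - Cinv ^+ 2) / (2 * gamma) * normDG_sq kappa gamma u <= aDG kappa gamma u u.
Proof. by move=> /aDG_equiv/andP[]. Qed.

Lemma aDG_bounded u : VDG u -> aDG kappa gamma u u <= 2 * normDG_sq kappa gamma u.
Proof. by move=> /aDG_equiv/andP[]. Qed.

Lemma aDG_semi_inner : semi_inner (@VDG _ m) (aDG kappa gamma).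
Proof.
split=> [u v hu hv|c u v w hu hv hw|u hu].
- rewrite !aDGE// (formC aH_semi_inner)// (formC jump_form_semi_inner)//.
  by rewrite [consistency u v + _]addrC.
- have huv : VDG (c *: u + v) by case: VDG_subspace => _; exact.
  rewrite !aDGE// consistency_linl// consistency_linr//.
  case: aH_semi_inner => _ -> // _; case: jump_form_semi_inner => _ -> // _.
  move: (aH kappa u w) (aH kappa v w) (jump_form u w) (jump_form v w).
  move: (consistency u w) (consistency v w) (consistency w u) (consistency w v).
  by move=> *; ring.
- apply: le_trans (aDG_coercive hu); rewrite mulr_ge0//.
    by rewrite divr_ge0// ?subr_ge0 ?(ltW Cinv_lt)// mulr_ge0// ltW.
  rewrite normDG_sqE addr_ge0 ?(form_ge0 aH_semi_inner)//.
  by rewrite mulr_ge0 ?(form_ge0 jump_form_semi_inner)// ltW.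
Qed.

(** Galerkin orthogonality makes the Galerkin error minimal in the symmetric
    positive form a_DG; coercivity and boundedness transfer this to the norm. *)
Lemma galerkin_quasi_optimal (S : set (broken m)) u U v :
  is_subspace S -> S `<=` @VDG _ m -> VDG u -> S U -> S v ->
  (forall w, S w -> aDG kappa gamma u w = aDG kappa gamma U w) ->
  (gamma - Cinv ^+ 2) / (2 * gamma) * normDG_sq kappa gamma (u - U) <=
  2 * normDG_sq kappa gamma (u - v).
Proof.
move=> hS SV hu hU hv orth.
have sub (a b : broken m) : VDG a -> VDG b -> VDG (a - b) by exact: (subspaceB VDG_subspace).
have hUV := SV _ hU; have hvV := SV _ hv; have hz := subspaceB hS hv hU.
have hzV := SV _ hz; have huU := sub _ _ hu hUV; have huv := sub _ _ hu hvV.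
apply: (le_trans (aDG_coercive huU)); apply: le_trans (aDG_bounded huv).
have -> : u - v = (u - U) - (v - U) by rewrite opprB addrA subrK.
have o : aDG kappa gamma (u - U) (v - U) = 0.
  by rewrite (formBl VDG_subspace aDG_semi_inner hu hUV hzV) (orth _ hz) subrr.
rewrite (form_sqB VDG_subspace aDG_semi_inner huU hzV) o mulr0 subr0.
by rewrite lerDl; exact: (form_ge0 aDG_semi_inner).
Qed.

End Penalty.

(** The square of a jump is at most twice the sum of the squares of the traces,
    and kappa_bar is at most the kappa_tilde of each adjacent block. *)
Lemma jump_form_boundary u : VDG u -> jump_form u u <=
  2 * (fine_size m)^-1 *
  \sum_(i < nblk m) kappa_tilde kappa i * bd_form i (u i) (u i).
Proof.
move=> hu.
pose F i e := kappa_tilde (m := m) kappa i *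
  line_integral (@edge _ m e) (fun x => u i x * u i x).
have -> : \sum_(i < nblk m) kappa_tilde kappa i * bd_form i (u i) (u i) =
    \sum_(i < nblk m) \sum_(e < nedge m | adj i e) F i e.
  by apply: eq_bigr => i _; rewrite /bd_form /bd_integral mulr_sumr.
rewrite sum_adj mulr_sumr; apply: ler_sum => e _.
rewrite -[2 * _]mulrC -mulrA ler_wpM2l ?invr_ge0 ?(ltW h_gt0)//.
have cu i : adj i e -> edge_cont (edge e) (u i) by exact: (Vh_bd_cont (hu i)).
have ct i : adj i e -> edge_cont (edge e) (fun x => u i x * u i x).
  by move=> ie; apply: edge_contM; exact: cu.
have kp := @kappa_bar_le _ m kappa _ _ (adj_eplus e).
have cj := @jj_cont e u u hu hu; have k0 := ltW (kbar_gt0 e).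
rewrite /F; case ej : (eminus e) => [j|].
  have km := @kappa_bar_le _ m kappa _ _ (adj_eminus ej).
  have cp := ct _ (adj_eplus e); have cm := ct _ (adj_eminus ej).
  rewrite mulrDr (mulrA 2) (mulrA 2 (kappa_tilde kappa j)).
  rewrite -(line_integralZ _ cp) -(line_integralZ _ cm) -line_integralD; [|exact: edge_contZ..].
  apply: le_line_integral => //; first by apply: edge_contD; exact: edge_contZ.
  move=> x _; rewrite /jump ej; set a := u _ x; set b := u _ x.
  apply: (@le_trans _ _ (kappa_bar kappa e * (2 * (a * a) + 2 * (b * b)))).
    rewrite -mulrA ler_wpM2l// -subr_ge0 (_ : _ - _ = (a + b) ^+ 2); last by ring.
    exact: sqr_ge0.
  rewrite mulrDr lerD//.
    by rewrite mulrCA -mulrA ler_wpM2l// ler_wpM2r// -expr2 sqr_ge0.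
  by rewrite mulrCA -mulrA ler_wpM2l// ler_wpM2r// -expr2 sqr_ge0.
have cp := ct _ (adj_eplus e).
rewrite addr0 (mulrA 2) -(line_integralZ _ cp).
apply: le_line_integral => //; first exact: edge_contZ.
move=> x _; rewrite /jump ej -!mulrA; set a := u _ x.
have a0 : 0 <= a * a by rewrite -expr2 sqr_ge0.
apply: (@le_trans _ _ (kappa_tilde kappa (eplus e) * (a * a))); first exact: ler_wpM2r.
have : 0 <= kappa_tilde kappa (eplus e) * (a * a).
  by rewrite mulr_ge0//; exact: kappa_tilde_ge0.
lra.
Qed.

Lemma jump_boundary0 e v x : (forall i, Vh0 i (v i)) -> segment (edge e) x ->
  jump e v x = 0.
Proof.
move=> hv xe; have v0 i : adj i e -> v i x = 0.
  by move=> /adjP/(_ _ xe); case: (hv i) => _; exact.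
rewrite /jump; case ej : (eminus e) => [j|]; rewrite v0 ?adj_eplus//.
by rewrite v0 ?subr0//; exact: adj_eminus.
Qed.

Lemma jump_form_Vh0 u v : (forall i, Vh0 i (v i)) -> jump_form u v = 0.
Proof.
move=> hv; apply: big1 => e _.
rewrite (eq_line_integral (g := fun=> 0)) ?line_integral0 ?mulr0// => x xe.
by rewrite (jump_boundary0 hv xe) mulr0.
Qed.

Lemma consistency_Vh0 u v : (forall i, Vh0 i (v i)) -> consistency u v = 0.
Proof.
move=> hv; apply: big1 => e _.
rewrite (eq_line_integral (g := fun=> 0)) ?line_integral0// => x xe.
by rewrite (jump_boundary0 hv xe) mulr0.
Qed.

End DGForm.

(** * The error estimate *)

Section OfflineSpace.
Context {R : realType} (m : mesh R).

Lemma in_span_subspace n (b : nat -> plane R -> R) : is_subspace (in_span n b).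
Proof.
split; first by exists (fun=> 0); apply/funext => x; rewrite big1// => k _; rewrite mul0r.
move=> c _ _ [p ->] [q ->]; exists (fun k => c * p k + q k); apply/funext => x.
rewrite lincombE mulr_sumr -big_split/=; apply: eq_bigr => k _.
by rewrite mulrDl mulrA.
Qed.

Lemma Voff_subspace phi xi l1 l2 : is_subspace (@Voff R m phi xi l1 l2).
Proof.
split=> [i|c u v hu hv i].
  have [z1 _] := in_span_subspace (l1 i) (phi i).
  have [z2 _] := in_span_subspace (l2 i) (xi i).
  by exists 0, 0; split=> //; apply/funext => x /=; rewrite addr0.
have [u1 [u2 [hu1 hu2 uE]]] := hu i; have [v1 [v2 [hv1 hv2 vE]]] := hv i.
exists (c *: u1 + v1), (c *: u2 + v2); split.
- by case: (in_span_subspace (l1 i) (phi i)) => _; apply.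
- by case: (in_span_subspace (l2 i) (xi i)) => _; apply.
rewrite (_ : (c *: u + v) i = c *: u i + v i)// uE vE.
by apply/funext => x; rewrite /= !lincombE/=; ring.
Qed.

End OfflineSpace.

Lemma absorb_energy (R : realFieldType) (a l c s j : R) :
  a = l + c -> 2 * l <= s + a -> 2 * c <= 2^-1 * a + 2 * j ->
  a <= 2 * s + 4 * j.
Proof. by move=> E L J; lra. Qed.

Lemma total_energy (R : realDomainType) (a b g s1 s2 s3 j : R) :
  a <= s1 + b -> b <= 2 * s3 + 4 * j -> g <= 2 * s2 -> 0 <= s1 -> 0 <= s2 -> 0 <= s3 ->
  2 * (a + g) <= 8 * (s1 + s2 + s3 + j).
Proof. by move=> A B G h1 h2 h3; lra. Qed.

Section ErrorEstimate.
Context {R : realType} (m : mesh R).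
Local Notation pt := (plane R).
Variables (gamma Cinv : R).
Hypotheses (gamma_gt0 : 0 < gamma) (Cinv_gt0 : 0 < Cinv)
  (Cinv_lt : Cinv ^+ 2 < gamma).
Variables (kappa f : pt -> R) (B : R).
Hypotheses (kappa_meas : measurable_fun (dom m) kappa)
  (kappa_le : forall x, dom m x -> kappa x <= B)
  (kappa_ge1 : forall x, dom m x -> 1 <= kappa x)
  (f_meas : measurable_fun (dom m) f)
  (f_L2 : area.-integrable (dom m) (fun x => (f x ^+ 2)%:E))
  (hinv : inverse_inequality m kappa Cinv).
Variables (M1 M2 : 'I_(nblk m) -> nat) (phi xi : 'I_(nblk m) -> nat -> pt -> R)
  (lam1 lam2 : 'I_(nblk m) -> nat -> R).
Hypotheses (hphi : forall i, eigenpairs1 kappa i (M1 i) (phi i) (lam1 i))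
  (hxi : forall i, eigenpairs2 kappa i (M2 i) (xi i) (lam2 i)).
Variables (l1 l2 : 'I_(nblk m) -> nat).
Hypotheses (hl1 : forall i, (l1 i < M1 i)%N /\ 0 < lam1 i (l1 i))
  (hl2 : forall i, (l2 i < M2 i)%N /\ 0 < lam2 i (l2 i)).
Local Opaque aK flux line_integral fine_size coarse_size kappa_blk kappa_tilde.

Let flux_bd (i : 'I_(nblk m)) u : Vh i u -> Vh_bd i (flux kappa i u).
Proof. exact: (flux_Vh_bd kappa_meas kappa_le kappa_ge1 (hphi i)). Qed.

Let flux_linear (i : 'I_(nblk m)) c u v : Vh i u -> Vh i v ->
  flux kappa i (c *: u + v) = c *: flux kappa i u + flux kappa i v.
Proof. exact: (flux_lincomb kappa_meas kappa_le kappa_ge1 (hphi i) (hxi i)). Qed.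

Let flux_le (i : 'I_(nblk m)) u : Vh i u ->
  bd_form i (flux kappa i u) (flux kappa i u) <=
  kappa_blk kappa i * Cinv ^+ 2 / fine_size m * aK kappa i u u.
Proof. exact: (flux_bound kappa_meas kappa_le kappa_ge1 (hphi i) (hxi i) Cinv_gt0 hinv). Qed.

Let aKs (i : 'I_(nblk m)) : semi_inner (Vh i) (aK kappa i).
Proof. exact: (aK_semi_inner kappa_meas kappa_le kappa_ge1). Qed.

Let h_gt0 : 0 < fine_size m. Proof. exact: fine_size_gt0. Qed.

Lemma Voff_VDG : Voff phi xi l1 l2 `<=` @VDG _ m.
Proof.
move=> v hv i; have [v1 [v2 [h1 h2 ->]]] := hv i.
apply: (@subspaceD _ _ _ v1 v2 (@Vh_subspace _ m i)).
  exact: (span1_Vh (hphi i) (hl1 i).1 h1).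
by case: (span2_Vh (hxi i) (hl2 i).1 h2).
Qed.

(** Testing the fine grid equation against the bubble part e2 of the error:
    the traces of e2 vanish, so only its energy, the load and the flux of e2
    against the jump of uh remain. *)
Lemma interior_energy uh u1 u2 e2 : VDG uh ->
  (forall v, VDG v -> aDG kappa gamma uh v = load f v) ->
  (forall i, V1snap kappa i (u1 i)) -> (forall i, Vh0 i (u2 i)) ->
  (forall i, uh i = u1 i + u2 i) ->
  (forall i, Vh0 i (e2 i)) ->
  (forall i, aK kappa i (u2 i) (e2 i) = aK kappa i (e2 i) (e2 i)) ->
  (forall i, mass kappa i (e2 i) (e2 i) <=
     coarse_size m ^+ 2 / lam2 i (l2 i) * aK kappa i (e2 i) (e2 i)) ->
  aH kappa e2 e2 <= 2 * (\sum_(i < nblk m) coarse_size m ^+ 2 / lam2 i (l2 i) *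
      \int[area]_(x in blk i) (f x ^+ 2)) + 4 * (Cinv ^+ 2 * jump_form kappa uh uh).
Proof.
move=> huh eqn hu1 hu2 uhE he2 ae me.
have e2V : VDG e2 by move=> i; case: (he2 i).
have c0 : 0 < Cinv ^+ 2 by exact: exprn_gt0.
have E : aH kappa e2 e2 = load f e2 + consistency kappa e2 uh.
  have := eqn _ e2V; rewrite (aDGE flux_bd)//.
  rewrite (consistency_Vh0 _ _ he2) (jump_form_Vh0 _ _ he2) mulr0 addr0 add0r.
  move=> <-; rewrite subrK; apply: eq_bigr => i _.
  have /V1snapP[u1V u10] := hu1 i; have [u2V _] := hu2 i.
  by rewrite uhE (formDl (aKs i) u1V u2V (e2V i)) (u10 _ (he2 i)) add0r ae.
have L : 2 * load f e2 <= \sum_(i < nblk m) coarse_size m ^+ 2 / lam2 i (l2 i) *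
    \int[area]_(x in blk i) (f x ^+ 2) + aH kappa e2 e2.
  rewrite /load /aH mulr_sumr -big_split; apply: ler_sum => i _ /=.
  have s0 : 0 < coarse_size m ^+ 2 / lam2 i (l2 i).
    exact: (divr_gt0 (exprn_gt0 _ (coarse_size_gt0 i)) (hl2 i).2).
  have := load_block_young kappa_meas kappa_le kappa_ge1 s0 f_meas f_L2 (e2V i).
  move=> /le_trans; apply; rewrite lerD2l.
  rewrite -(ler_pM2l s0) mulrA mulfV ?gt_eqF// mul1r; exact: me.
(* With this weight, half of the energy of e2 is absorbed. *)
have t0 : 0 < (2 * Cinv ^+ 2)^-1 by rewrite invr_gt0 mulr_gt0.
have J := consistency_young kappa_le kappa_ge1 flux_bd flux_le t0 e2V huh.
move: J; rewrite invrK.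
have -> : (2 * Cinv ^+ 2)^-1 * Cinv ^+ 2 = 2^-1 by field; rewrite gt_eqF.
rewrite -[2 * Cinv ^+ 2 * _]mulrA => J.
exact: absorb_energy E L J.
Qed.

(** Quasi-optimality is applied to v, the sum of the truncated eigenexpansions
    of u1 and of the bubble part uh - u1. The tails e1 and e2 are orthogonal in
    energy, and only e1 has a trace, so only e1 contributes to the jumps. *)
Lemma error_estimate (uh uH u1 : broken m) : VDG uh ->
  (forall v, VDG v -> aDG kappa gamma uh v = load f v) ->
  Voff phi xi l1 l2 uH ->
  (forall v, Voff phi xi l1 l2 v -> aDG kappa gamma uH v = load f v) ->
  (forall i, harmonic_ext kappa i (uh i) (u1 i)) ->
  (gamma - Cinv ^+ 2) / (2 * gamma) *
    normDG_sq kappa gamma (fun i => uh i \- uH i) <=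
  8 * (\sum_(i < nblk m)
         coarse_size m / (kappa_tilde kappa i * lam1 i (l1 i))
         * (1 + gamma * coarse_size m / (fine_size m * lam1 i (l1 i)))
         * bd_integral i (fun x => flux kappa i (u1 i) x ^+ 2)
       + \sum_(i < nblk m)
         coarse_size m ^+ 2 / lam2 i (l2 i) * \int[area]_(x in blk i) (f x ^+ 2)
       + Cinv ^+ 2 * jump_form kappa uh uh).
Proof.
move=> huh uh_eq huH uH_eq hu1.
have u1S i : V1snap kappa i (u1 i).
  by apply/V1snapP; case: (hu1 i).
have u2S i : Vh0 i (uh i - u1 i).
  have [u1V u1b _] := hu1 i; split; first exact: (subspaceB (@Vh_subspace _ m i)).
  by move=> x xi'; rewrite -[LHS]/(uh i x - u1 i x) u1b// subrr.
pose T i := coarse_size m / (kappa_tilde kappa i * lam1 i (l1 i)) *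
  bd_integral i (fun x => flux kappa i (u1 i) x ^+ 2).
have /choice[p1 hp1] : forall i, exists p, in_span (l1 i) (phi i) p /\
    [/\ V1snap kappa i (u1 i - p), aK kappa i (u1 i - p) (u1 i - p) <= T i
      & kappa_tilde kappa i * bd_form i (u1 i - p) (u1 i - p) <=
        coarse_size m / lam1 i (l1 i) * T i].
  move=> i; have [p h1 h2] := V1_tail kappa_meas kappa_le kappa_ge1 (hphi i)
    (hl1 i).1 (hl1 i).2 (u1S i).
  by exists p; split; [exact: h1|exact: h2].
have /choice[p2 hp2] : forall i, exists p, in_span (l2 i) (xi i) p /\
    [/\ Vh0 i (uh i - u1 i - p),
        aK kappa i (uh i - u1 i) (uh i - u1 i - p) =
        aK kappa i (uh i - u1 i - p) (uh i - u1 i - p)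
      & mass kappa i (uh i - u1 i - p) (uh i - u1 i - p) <=
        coarse_size m ^+ 2 / lam2 i (l2 i) *
        aK kappa i (uh i - u1 i - p) (uh i - u1 i - p)].
  move=> i; have [p h1 h2] := V2_tail kappa_meas kappa_le kappa_ge1 (hxi i)
    (hl2 i).1 (hl2 i).2 (u2S i).
  by exists p; split; [exact: h1|exact: h2].
pose v : broken m := fun i => p1 i + p2 i.
pose e1 : broken m := fun i => u1 i - p1 i.
pose e2 : broken m := fun i => uh i - u1 i - p2 i.
have vS : Voff phi xi l1 l2 v.
  by move=> i; exists (p1 i), (p2 i); split; [exact: (hp1 i).1|exact: (hp2 i).1|].
have e1S i : V1snap kappa i (e1 i) by case: (hp1 i).2.
have e2S i : Vh0 i (e2 i) by case: (hp2 i).2.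
have e1V i : Vh i (e1 i) by have /V1snapP[] := e1S i.
have e2V i : Vh i (e2 i) by case: (e2S i).
have wE i : (uh - v) i = e1 i + e2 i.
  rewrite (_ : (uh - v) i = uh i - v i)// /v /e1 /e2.
  by rewrite [RHS]addrC addrACA subrK opprD addrA -addrA [- p2 i - p1 i]addrC addrA.
have vV := Voff_VDG vS; have wV := subspaceB (@VDG_subspace _ m) huh vV.
have Q := galerkin_quasi_optimal kappa_meas kappa_le kappa_ge1 flux_bd flux_linear
  flux_le gamma_gt0 Cinv_lt (@Voff_subspace _ m phi xi l1 l2) Voff_VDG huh huH vS.
have {}Q := Q (fun z hz => etrans (uh_eq z (Voff_VDG hz)) (esym (uH_eq z hz))).
apply: (le_trans Q); rewrite (normDG_sqE kappa gamma (uh - v)).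
have uhE i : uh i = u1 i + (uh i - u1 i) by rewrite addrC subrK.
have ae i : aK kappa i (uh i - u1 i) (e2 i) = aK kappa i (e2 i) (e2 i).
  by case: (hp2 i).2.
have me i : mass kappa i (e2 i) (e2 i) <=
    coarse_size m ^+ 2 / lam2 i (l2 i) * aK kappa i (e2 i) (e2 i).
  by case: (hp2 i).2.
have A2 := @interior_energy uh u1 (fun i => uh i - u1 i) e2 huh uh_eq u1S u2S
  uhE e2S ae me.
have A : aH kappa (uh - v) (uh - v) <= \sum_(i < nblk m) T i + aH kappa e2 e2.
  rewrite /aH -big_split; apply: ler_sum => i _ /=; rewrite wE.
  rewrite (form_sqD (@Vh_subspace _ m i) (aKs i) (e1V i) (e2V i)).
  have /V1snapP[_ /(_ _ (e2S i)) ->] := e1S i.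
  by rewrite mulr0 addr0 lerD2r; case: (hp1 i).2.
have J : gamma * jump_form kappa (uh - v) (uh - v) <=
    2 * \sum_(i < nblk m) gamma * coarse_size m / (fine_size m * lam1 i (l1 i)) * T i.
  apply: (@le_trans _ _ (gamma * (2 * (fine_size m)^-1 * \sum_(i < nblk m)
      coarse_size m / lam1 i (l1 i) * T i))).
    rewrite ler_wpM2l ?(ltW gamma_gt0)//.
    apply: (le_trans (jump_form_boundary kappa_le kappa_ge1 wV)).
    apply: ler_wpM2l; first by rewrite mulr_ge0// invr_ge0 (ltW h_gt0).
    apply: ler_sum => i _; have [_ _ hJ] := (hp1 i).2; apply: le_trans hJ.
    rewrite le_eqVlt; apply/orP; left; apply/eqP; congr (_ * _).
    apply: eq_bd_integral => x xi'; rewrite wE.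
    have [_ /(_ _ xi') e20] := e2S i.
    by rewrite -[(e1 i + e2 i) x]/(e1 i x + e2 i x) e20 addr0.
  rewrite le_eqVlt; apply/orP; left; apply/eqP.
  rewrite !mulr_sumr; apply: eq_bigr => i _; move: (T i) => Ti.
  move: h_gt0 (hl1 i).2 => h0 l0; move: h0 l0.
  move: (fine_size m) (coarse_size m) (lam1 i (l1 i)) => h H l h0 l0.
  by field; rewrite !gt_eqF.
have -> : \sum_(i < nblk m) coarse_size m / (kappa_tilde kappa i * lam1 i (l1 i))
         * (1 + gamma * coarse_size m / (fine_size m * lam1 i (l1 i)))
         * bd_integral i (fun x => flux kappa i (u1 i) x ^+ 2) =
    \sum_(i < nblk m) T i + \sum_(i < nblk m)
      gamma * coarse_size m / (fine_size m * lam1 i (l1 i)) * T i.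
  rewrite -big_split; apply: eq_bigr => i _ /=; rewrite /T.
  move: (coarse_size m / (_ * _)) (gamma * _ / _) (bd_integral _ _) => a b c.
  by ring.
have Ti0 i : 0 <= T i.
  have [_ aT _] := (hp1 i).2; apply: le_trans aT.
  exact: (form_ge0 (aKs i)).
have T0 : 0 <= \sum_(i < nblk m) T i by exact: sumr_ge0.
have T'0 : 0 <= \sum_(i < nblk m)
    gamma * coarse_size m / (fine_size m * lam1 i (l1 i)) * T i.
  apply: sumr_ge0 => i _; apply: mulr_ge0 (Ti0 i); apply: divr_ge0.
    exact: (mulr_ge0 (ltW gamma_gt0) (ltW (coarse_size_gt0 i))).
  exact: (mulr_ge0 (ltW h_gt0) (ltW (hl1 i).2)).
have S0 : 0 <= \sum_(i < nblk m)
    coarse_size m ^+ 2 / lam2 i (l2 i) * \int[area]_(x in blk i) (f x ^+ 2).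
  apply: sumr_ge0 => i _; apply: mulr_ge0.
    exact: (divr_ge0 (sqr_ge0 _) (ltW (hl2 i).2)).
  by apply: Rintegral_ge0 => x _; exact: sqr_ge0.
exact: total_energy A A2 J T0 T'0 S0.
Qed.

End ErrorEstimate.

Theorem theorem3p2 (R : realType) (gamma Cinv : R) (hgamma : 0 < gamma)
    (hCinv : 0 < Cinv) (hpenalty : Cinv ^+ 2 < gamma) :
  exists2 C : R, 0 < C &
  forall (m : mesh R) (kappa f : plane R -> R)
    (kappa_meas : measurable_fun (dom m) kappa)
    (kappa_bounded : exists B : R, forall x, dom m x -> kappa x <= B)
    (kappa_ge1 : forall x, dom m x -> 1 <= kappa x)
    (f_meas : measurable_fun (dom m) f)
    (f_L2 : area.-integrable (dom m) (fun x => (f x ^+ 2)%:E))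
    (hinv : inverse_inequality m kappa Cinv)
    (M1 M2 : 'I_(nblk m) -> nat)
    (phi xi : 'I_(nblk m) -> nat -> plane R -> R)
    (lam1 lam2 : 'I_(nblk m) -> nat -> R)
    (hphi : forall i, eigenpairs1 kappa i (M1 i) (phi i) (lam1 i))
    (hxi : forall i, eigenpairs2 kappa i (M2 i) (xi i) (lam2 i))
    (l1 l2 : 'I_(nblk m) -> nat)
    (hl1 : forall i, (l1 i < M1 i)%N /\ 0 < lam1 i (l1 i))
    (hl2 : forall i, (l2 i < M2 i)%N /\ 0 < lam2 i (l2 i))
    (uh uH u1 : broken m)
    (huh : VDG uh)
    (huh_eq : forall v, VDG v -> aDG kappa gamma uh v = load f v)
    (huH : Voff phi xi l1 l2 uH)
    (huH_eq : forall v, Voff phi xi l1 l2 v -> aDG kappa gamma uH v = load f v)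
    (hu1 : forall i, harmonic_ext kappa i (uh i) (u1 i)),
  let H := coarse_size m in
  let h := fine_size m in
  normDG_sq kappa gamma (fun i => uh i \- uH i) <=
  C * (\sum_(i < nblk m)
         H / (kappa_tilde kappa i * lam1 i (l1 i))
         * (1 + gamma * H / (h * lam1 i (l1 i)))
         * bd_integral i (fun x => flux kappa i (u1 i) x ^+ 2)
       + \sum_(i < nblk m)
         H ^+ 2 / lam2 i (l2 i) * \int[area]_(x in blk i) (f x ^+ 2)
       + Cinv ^+ 2 * \sum_(e < nedge m)
           h^-1 * line_integral (edge e)
                    (fun x => kappa_bar kappa e * jump e uh x ^+ 2)).
Proof.
have gC : 0 < gamma - Cinv ^+ 2 by rewrite subr_gt0.
have a0 : 0 < (gamma - Cinv ^+ 2) / (2 * gamma) by rewrite divr_gt0// mulr_gt0.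
exists (8 / ((gamma - Cinv ^+ 2) / (2 * gamma))); first by rewrite divr_gt0.
move=> m kappa f mk [B kB] k1 mf f2 hinv M1 M2 phi xi lam1 lam2 hphi hxi l1 l2.
move=> hl1 hl2 uh uH u1 huh uh_eq huH uH_eq hu1; cbv zeta.
have E := error_estimate hgamma hCinv hpenalty mk kB k1 mf f2 hinv hphi hxi hl1 hl2
  huh uh_eq huH uH_eq hu1.
have -> : \sum_(e < nedge m) (fine_size m)^-1 * line_integral (edge e)
    (fun x => kappa_bar kappa e * jump e uh x ^+ 2) = jump_form kappa uh uh.
  apply: eq_bigr => e _; congr (_ * line_integral _ _).
  by apply/funext => x; rewrite expr2 mulrA.
by rewrite -(ler_pM2l a0) [leRHS]mulrA [_ * (8 / _)]mulrC divfK ?gt_eqF.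
Qed.
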